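(* Let $\mathcal D$ be a dense linear subspace of a Hilbert space $\mathcal H$ such that $(\mathcal D,t)$ is an (F)-space, where $t$ is the graph topology induced by $\mathcal L^+(\mathcal D)$, and let $\mathcal A,\mathcal B\subset\mathcal L^+(\mathcal D)$ be standard operator $*$-algebras on $\mathcal D$. Let $k\in\mathbb Q$ and suppose that $\Phi\colon\mathcal A\to\mathcal B$ is a bijective mapping (no additivity is assumed) satisfying $$\Phi(kABA)=k\,\Phi(A)\Phi(B)\Phi(A)\quad\text{for all }A,B\in\mathcal A.$$ Then $\Phi=\pm\Psi$, where $\Psi$ is a ring isomorphism or a ring antiisomorphism. Therefore $\Phi$ has one of the following forms: (i) there exist a bijective, either linear or conjugate linear, operator $T\colon\mathcal D\to\mathcal D$ and $c\in\{-1,1\}$ such that $\Phi(A)=cTAT^{-1}$ for all $A\in\mathcal A$; or (ii) there exist a bijective, either linear or conjugate linear, operator $T\colon\mathcal D\to\mathcal D$ and $c\in\{-1,1\}$ such that $\Phi(A)=cTA^+T^{-1}$ for all $A\in\mathcal A$. If $T$ is linear, it belongs to $\mathcal L^+(\mathcal D)$.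
   Context: For a dense linear subspace $\mathcal D$ of a complex Hilbert space $\mathcal H$, $\mathcal L^+(\mathcal D)$ denotes the set of all linear operators $A\colon\mathcal D\to\mathcal D$ whose Hilbert space adjoint $A^*$ is defined on $\mathcal D$ and satisfies $A^*\mathcal D\subset\mathcal D$. It is a $*$-algebra with the usual operations and the involution $A\mapsto A^+:=A^*|_{\mathcal D}$. The graph topology $t$ on $\mathcal D$ is the locally convex topology generated by the seminorms $\phi\mapsto\|A\phi\|$, $A\in\mathcal L^+(\mathcal D)$. $(\mathcal D,t)$ is an (F)-space if it is a Fréchet space (metrizable and complete). $\mathcal F(\mathcal D)\subset\mathcal L^+(\mathcal D)$ is the ideal of all finite rank operators on $\mathcal D$ in $\mathcal L^+(\mathcal D)$. A standard operator $*$-algebra on $\mathcal D$ is a $*$-subalgebra of $\mathcal L^+(\mathcal D)$ containing $\mathcal F(\mathcal D)$. A ring antiisomorphism is an additive bijection $\Psi$ with $\Psi(AB)=\Psi(B)\Psi(A)$.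
   Formalization: Assumes k ≠ 0 and H infinite-dimensional: for k = 0 the condition says only Φ(0) = 0, and for 1 ≤ dim H < ∞ the claim fails (z ↦ z|z| on ℂ with k = 1; a discontinuous field automorphism applied entrywise on M_n(ℂ), n ≥ 2). *)

(* Defs.v *)
From HB Require Import structures.
From mathcomp Require Import all_boot all_order all_algebra.
From mathcomp Require Import sesquilinear.
From mathcomp Require Import all_classical all_reals all_analysis.
From mathcomp Require Import complex.

Set Implicit Arguments.
Unset Strict Implicit.
Unset Printing Implicit Defensive.

Import Order.TTheory GRing.Theory Num.Theory.
Import numFieldNormedType.Exports.

Local Open Scope classical_set_scope.
Local Open Scope ring_scope.

(* [inner] is linear in its first argument and conjugate linear in the second;
   the norm of the underlying complete normed module is the Hilbert norm. *)
HB.mixin Record CompleteNormedModule_isHilbert (R : realType) H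
    & CompleteNormedModule R[i] H := {
  inner : {dot H for @Num.conj R[i]} ;
  innerxx : forall x : H, inner x x = `|x| ^+ 2
}.

#[short(type="hilbertType")]
HB.structure Definition Hilbert (R : realType) :=
  { H of CompleteNormedModule R[i] H & CompleteNormedModule_isHilbert R H }.

Section Domain.
Context {R : realType} {H : hilbertType R} (D : submodClosed H).

Definition dom : Type := {x : H | x \in D}.

HB.instance Definition _ := SubChoice.on dom.
HB.instance Definition _ := [SubChoice_isSubLmodule of dom by <:].

Definition dom_incl (phi : dom) : H := val phi.

Let dom_incl_linear : linear dom_incl.
Proof. by move=> a x y; rewrite /dom_incl linearP. Qed.

HB.instance Definition _ :=
  GRing.isLinear.Build R[i] dom H *:%R dom_incl dom_incl_linear.

End Domain.

Section Operators.
Context {R : realType} {H : hilbertType R} {D : submodClosed H}.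
Implicit Types (A B T : dom D -> dom D) (S : set (dom D -> dom D)).

Definition finite_dim (V : lmodType R[i]) (X : set V) : Prop :=
  exists (n : nat) (e : 'I_n -> V), forall x, X x ->
    exists c : 'I_n -> R[i], x = \sum_(i < n) c i *: e i.

Definition adjoint_graph A (psi eta : H) : Prop :=
  forall phi : dom D, inner (dom_incl (A phi)) psi = inner (dom_incl phi) eta.

Definition adjoint_dom A : set H :=
  [set psi | exists eta, adjoint_graph A psi eta].

(* When [D] is dense, [eta] is unique: [adjoint A] is the Hilbert space adjoint
   [A^*], extended by [0] outside [adjoint_dom A]. *)
Definition adjoint A (psi : H) : H :=
  xget 0 [set eta | adjoint_graph A psi eta].

Definition Lplus : set (dom D -> dom D) :=
  [set A | [/\ linear A,
               forall phi : dom D, adjoint_dom A (dom_incl phi) &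
               forall phi : dom D, adjoint A (dom_incl phi) \in D]].

(* [A^+], the restriction of [A^*] to [D]; the default value [0] of [insubd] is
   irrelevant on [Lplus]. *)
Definition adj_plus A : dom D -> dom D :=
  fun phi => insubd 0 (adjoint A (dom_incl phi)).

Definition finite_rank_op : set (dom D -> dom D) :=
  [set A | Lplus A /\ finite_dim (range A)].

(* The unit is not required to belong to [S]. *)
Record standard_star_algebra S : Prop := {
  ssa_Lplus : S `<=` Lplus ;
  ssa_finite_rank : finite_rank_op `<=` S ;
  ssa_add : forall A B, S A -> S B -> S (fun x => A x + B x) ;
  ssa_scale : forall (a : R[i]) A, S A -> S (fun x => a *: A x) ;
  ssa_mul : forall A B, S A -> S B -> S (A \o B) ;
  ssa_plus : forall A, S A -> S (adj_plus A)
}.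

Definition conj_linear T : Prop :=
  forall (a : R[i]) (x y : dom D), T (a *: x + y) = (Num.conj a) *: T x + T y.

End Operators.

(* The locally convex topology generated by the seminorms [phi |-> `|A phi|],
   [A] in [Lplus], given through its translation invariant uniform structure:
   basic entourages are indexed by finitely many seminorms and a radius. *)
Section GraphTopology.
Context {R : realType} {H : hilbertType R} (D : submodClosed H).

Definition graph_space : Type := dom D.

HB.instance Definition _ := Choice.on graph_space.

Definition graph_ball (s : seq (dom D -> dom D)) (eps : R[i]) :
    set (graph_space * graph_space) :=
  [set p | forall A : dom D -> dom D, A \in s ->
             `|dom_incl (A ((p.1 : dom D) - (p.2 : dom D)))| < eps].

Definition graph_ent : set_system (graph_space * graph_space) :=
  [set E | exists (s : seq (dom D -> dom D)) (eps : R[i]),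
    [/\ forall A : dom D -> dom D, A \in s -> Lplus A,
        0 < eps & graph_ball s eps `<=` E]].

Let graph_ent_filter : Filter graph_ent.
Proof.
split.
- by exists [::], 1; split.
- move=> E F [s [e [sL e0 sE]]] [t [f [tL f0 tF]]].
  have ef : e >=< f by rewrite real_comparable ?gtr0_real.
  exists (s ++ t), (Num.min e f); split.
  + by move=> A; rewrite mem_cat => /orP[/sL|/tL].
  + by rewrite comparable_lt_min // e0 f0.
  + move=> p p_st; split; [apply: sE|apply: tF] => A As.
      have /p_st : A \in s ++ t by rewrite mem_cat As.
      by rewrite comparable_lt_min // => /andP[].
    have /p_st : A \in s ++ t by rewrite mem_cat As orbT.
    by rewrite comparable_lt_min // => /andP[].
- move=> E F EF [s [e [sL e0 sE]]]; exists s, e; split=> // p ps.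
  by apply: EF; apply: sE.
Qed.

Let graph_ent_diag E : graph_ent E -> diagonal `<=` E.
Proof.
move=> [s [e [sL e0 sE]]] [x y] /= xy; apply: sE => A /sL[linA _ _] /=.
have /= -> : x = y by exact: xy.
have -> : A ((y : dom D) - (y : dom D)) = 0.
  by rewrite (zmod_morphism_linear linA) subrr.
by rewrite raddf0 normr0.
Qed.

Let graph_ent_inv E : graph_ent E -> graph_ent E^-1%relation.
Proof.
move=> [s [e [sL e0 sE]]]; exists s, e; split=> // -[x y] xy.
apply: sE => A As /=.
have [linA _ _] := sL _ As.
have := xy _ As; rewrite /= !(zmod_morphism_linear linA).
by rewrite !raddfB distrC.
Qed.

Let graph_ent_split E : graph_ent E ->
  exists2 F, graph_ent F & (F \; F)%relation `<=` E.
Proof.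
move=> [s [e [sL e0 sE]]]; exists (graph_ball s (e / 2)).
  by exists s, (e / 2); split=> //; rewrite divr_gt0.
move=> [x y] [z /= xz zy]; apply: sE => A As /=.
have [linA _ _] := sL _ As.
have := ltrD (xz _ As) (zy _ As); rewrite /= -splitr; apply: le_lt_trans.
by rewrite !(zmod_morphism_linear linA) !raddfB; exact: ler_distD.
Qed.

HB.instance Definition _ := isUniform.Build graph_space
  graph_ent_filter graph_ent_diag graph_ent_inv graph_ent_split.

End GraphTopology.

Definition metrizable (R : realType) (X : topologicalType) : Prop :=
  exists d : X -> X -> R,
    [/\ forall x y, d x y = 0 <-> x = y,
        forall x y, d x y = d y x,
        forall x y z, d x z <= d x y + d y z &
        forall (x : X) (U : set X), nbhs x U <->
          exists2 eps : R, 0 < eps & [set y | d x y < eps] `<=` U].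

Definition complete_space (X : uniformType) : Prop :=
  forall F : set_system X, ProperFilter F -> cauchy F ->
    exists x : X, F --> x.

(* Local convexity holds by construction of the graph topology. *)
Definition graph_frechet (R : realType) (H : hilbertType R)
    (D : submodClosed H) : Prop :=
  metrizable R (graph_space D) /\ complete_space (graph_space D).

Section RingMorphisms.
Context {R : realType} {H : hilbertType R} {D : submodClosed H}.
Implicit Types (S U : set (dom D -> dom D)).
Implicit Types (Psi : (dom D -> dom D) -> (dom D -> dom D)).

Definition additive_on S Psi : Prop :=
  forall A B, S A -> S B ->
    Psi (fun x => A x + B x) = (fun x => Psi A x + Psi B x).

Definition ring_isomorphism S U Psi : Prop :=
  [/\ set_bij S U Psi, additive_on S Psi &
      forall A B, S A -> S B -> Psi (A \o B) = Psi A \o Psi B].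

Definition ring_antiisomorphism S U Psi : Prop :=
  [/\ set_bij S U Psi, additive_on S Psi &
      forall A B, S A -> S B -> Psi (A \o B) = Psi B \o Psi A].

End RingMorphisms.

(* Main.v *)
Require Import Defs.
From HB Require Import structures.
From mathcomp Require Import all_boot all_order all_algebra.
From mathcomp Require Import sesquilinear.
From mathcomp Require Import all_classical all_reals all_analysis.
From mathcomp Require Import complex.
From mathcomp Require Import ring.
Import Order.TTheory GRing.Theory Num.Theory.
Import numFieldNormedType.Exports.
Local Open Scope classical_set_scope.
Local Open Scope ring_scope.

Set Implicit Arguments.
Unset Strict Implicit.
Unset Printing Implicit Defensive.

(** Replacing [Phi] by [phi A = s Phi(s^-1 A)], where [s ^ 2 = k], gives a
    bijection with [phi(ABA) = phi(A) phi(B) phi(A)]; so the constant [k] only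
    matters at the very end, where it decides a sign.

    The whole structure of [phi] is read off the rank-one operators
    [rk1 f g = (x |-> <x, g> f)].  Since [ABA = <B f, g> A] when [A = rk1 f g],
    a rank-one [A] can be recovered, by the triple product, from each of the
    nonzero [ABA]; no operator of higher rank has this property, because some
    nonzero [ABA] has rank one.  Hence [phi] permutes the rank-one operators
    ([jt_rk1], [jt_rk1_surj]), and applying [phi] to [ABA = <B f, g> A] shows
    that, when [phi (rk1 f g) = rk1 f' g'], the scalar [<phi(B) f', g'>] is a
    function [mu] of the scalar [<B f, g>].  This [mu] is multiplicative and
    independent of the rank-one operator ([transported_uniform]).

    Additivity comes for free from linear algebra: the pairings with
    [rk1 e0 e0], [rk1 e0 e1] and [rk1 e0 (e0 + e1)] are linear forms on the
    operators, and [phi] maps them to three linear forms of which the third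
    still vanishes where the first two do; this linear dependence is the
    additivity of [mu] ([mu_add]).  As pairings with rank-one operators separate
    operators, [phi] is additive and [mu]-semilinear ([phi_semilinear]).

    For an additive [phi], all [phi (rk1 e0 y)] share one factor, because a sum
    of two rank-one operators has rank at most one only if they share a factor.
    Up to a sign, and up to precomposition with the adjoint, this gives
    [phi (rk1 e0 y) = rk1 a (S y)] and [phi (rk1 x e0) = rk1 (T x) b].  The
    polarized triple identity then yields [phi (rk1 x y) = rk1 (T x) (S y)] and
    [<T x, S y> = mu <x, y>], whence [phi A = T A T^-1] ([phi_implemented]).

    It remains to see that [mu] is the identity or the conjugation, that is, that
    [mu] is bounded near [0].  Here infinite dimension and the (F)-space
    property of the domain are used: along an orthonormal sequence [e n] of the domain,
    every sequence [c n] of scalars that decreases fast enough is the sequence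
    of coefficients of some [x] in the domain ([frechet_series]), and
    [|mu (c n)| = |<T x, z n>| <= |T x| |z n|], where [z n] is the vector dual to
    [e n].  Were [mu] unbounded near [0], one could choose small [c n] with
    [|mu (c n)| > n |z n|] ([semilinear_factor_bounded]). *)

(** * Rank-one operators on a pre-Hilbert space *)

Section PreHilbert.
Context {C : numClosedFieldType} {V : lmodType C} (form : {dot V for Num.conj}).
Local Notation "''[' u , v ]" := (form u%R v%R) : ring_scope.
Implicit Types (x y f g u v w : V) (A B : V -> V) (S : set (V -> V)).

Lemma dotC u v : '[u, v] = Num.conj '[v, u].
Proof. by rewrite hermC expr0 mul1r. Qed.

Lemma dotZl a u v : '[a *: u, v] = a * '[u, v].
Proof. exact: (linearZl_LR form). Qed.

Lemma dotZr a u v : '[u, a *: v] = Num.conj a * '[u, v].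
Proof. exact: (linearZr_LR form). Qed.

Lemma dotDl u v w : '[u + v, w] = '[u, w] + '[v, w].
Proof. exact: (linearDl form). Qed.

Lemma dotDr u v w : '[w, u + v] = '[w, u] + '[w, v].
Proof. exact: (linearDr form). Qed.

Lemma dotBl u v w : '[u - v, w] = '[u, w] - '[v, w].
Proof. exact: (linearBl form). Qed.

Lemma dotBr u v w : '[w, u - v] = '[w, u] - '[w, v].
Proof. exact: (linearBr form). Qed.

Lemma dot0l w : '[0, w] = 0. Proof. exact: (linear0l form). Qed.
Lemma dot0r w : '[w, 0] = 0. Proof. exact: (linear0r form). Qed.

Lemma dot_suml I (r : seq I) (F : I -> V) w :
  '[\sum_(i <- r) F i, w] = \sum_(i <- r) '[F i, w].
Proof. exact: (linear_sumlz form). Qed.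

Lemma dot_sumr I (r : seq I) (F : I -> V) w :
  '[w, \sum_(i <- r) F i] = \sum_(i <- r) '[w, F i].
Proof. exact: (linear_sumr form). Qed.

Lemma dot_ext u v : (forall w, '[u, w] = '[v, w]) -> u = v.
Proof.
move=> uv; apply/eqP; rewrite -subr_eq0 -(dnorm_eq0 form) dotBl.
by rewrite uv subrr.
Qed.

Lemma dot_extr u v : (forall w, '[w, u] = '[w, v]) -> u = v.
Proof. by move=> uv; apply: dot_ext => w; rewrite dotC uv -dotC. Qed.

Lemma dot_CauchySchwarz u v : `|'[u, v]| ^+ 2 <= '[u, u] * '[v, v].
Proof.
have [->|v0] := eqVneq v 0; first by rewrite !dot0r normr0 mulr0 expr0n.
have v2 : 0 < '[v, v] by rewrite dnorm_gt0.
rewrite -(ler_pM2l v2) -subr_ge0.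
have -> : '[v, v] * ('[u, u] * '[v, v]) - '[v, v] * `|'[u, v]| ^+ 2 =
    '['[v, v] *: u - '[u, v] *: v, '[v, v] *: u - '[u, v] *: v].
  rewrite dotBl !dotBr !dotZl !dotZr -(dotC v v) (dotC v u) normCK; ring.
exact: dnorm_ge0.
Qed.

Definition rk1 f g : V -> V := fun x => '[x, g] *: f.

Lemma rk1_eq0 f g : f != 0 -> rk1 f g = (fun=> 0) -> g = 0.
Proof.
move=> f0 /(congr1 (@^~ g)); rewrite /rk1 => /eqP.
by rewrite scaler_eq0 (negPf f0) orbF dnorm_eq0 => /eqP.
Qed.

Lemma rk1_neq0 f g : f != 0 -> g != 0 -> rk1 f g <> (fun=> 0).
Proof. by move=> f0 /eqP g0 /rk1_eq0 => /(_ f0). Qed.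

Lemma rk1_neq0P f g : rk1 f g <> (fun=> 0) -> f != 0 /\ g != 0.
Proof.
move=> fg; split; apply/eqP => z; apply: fg; apply/funext => x; rewrite /rk1 z.
  by rewrite scaler0.
by rewrite dot0r scale0r.
Qed.

Lemma rk1Zl a f g : rk1 (a *: f) g = (fun x => a *: rk1 f g x).
Proof. by apply/funext => x; rewrite /rk1 !scalerA mulrC. Qed.

Lemma rk1_linear f g : linear (rk1 f g).
Proof. by move=> a x y; rewrite /rk1 dotDl dotZl scalerDl scalerA. Qed.

Definition adjoint_pair A B := forall x y, '[A x, y] = '[x, B y].

Lemma adjoint_pair_sym A B : adjoint_pair A B -> adjoint_pair B A.
Proof. by move=> AB x y; rewrite dotC -AB -dotC. Qed.

Lemma adjoint_pair_uniq A B B' : adjoint_pair A B -> adjoint_pair A B' -> B = B'.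
Proof.
by move=> AB AB'; apply/funext => y; apply: dot_extr => x; rewrite -AB AB'.
Qed.

Lemma adjoint_pair_linear A B : adjoint_pair A B -> linear A.
Proof.
move=> AB a x y; apply: dot_ext => w.
by rewrite AB !dotDl !dotZl !AB.
Qed.

Lemma rk1_adjoint f g : adjoint_pair (rk1 f g) (rk1 g f).
Proof.
by move=> x y; rewrite /rk1 dotZl dotZr mulrC (dotC y f) conjCK.
Qed.

(** The features of a standard operator [*]-algebra that involve the inner product
    of the domain only. *)
Record star_algebra S : Prop := {
  sa_adj : forall A, S A -> exists2 B, S B & adjoint_pair A B ;
  sa_rk1 : forall f g, S (rk1 f g) ;
  sa_add : forall A B, S A -> S B -> S (fun x => A x + B x) ;
  sa_scale : forall (a : C) A, S A -> S (fun x => a *: A x) ;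
  sa_mul : forall A B, S A -> S B -> S (fun x => A (B x))
}.

Lemma sa_linear S A : star_algebra S -> S A -> linear A.
Proof. by move=> SS /(sa_adj SS)[B _ /adjoint_pair_linear]. Qed.

Lemma linear_at0 A : linear A -> A 0 = 0.
Proof. by move=> lA; have := lA (-1) 0 0; rewrite !scaleN1r !addNr. Qed.

Lemma linear_atD A x y : linear A -> A (x + y) = A x + A y.
Proof. by move=> lA; have := lA 1 x y; rewrite !scale1r. Qed.

Lemma linear_atZ A a x : linear A -> A (a *: x) = a *: A x.
Proof. by move=> lA; have := lA a x 0; rewrite (linear_at0 lA) !addr0. Qed.

Lemma sa_zero S : star_algebra S -> S (fun=> 0).
Proof.
move=> SS; have := sa_rk1 SS 0 0; congr S.
by apply/funext => x; rewrite /rk1 scaler0.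
Qed.

(** A description of the rank-one operators in terms of the triple product
    [ABA] and of [0] alone, so that triple isomorphisms preserve it. *)
Definition triple_minimal S A := A <> (fun=> 0) /\
  forall B, S B -> (fun x => A (B (A x))) = (fun=> 0) \/
    exists2 X, S X & A = (fun x => A (B (A (X (A (B (A x))))))).

Lemma rk1_sandwich f g B x : linear B ->
  rk1 f g (B (rk1 f g x)) = '[B f, g] *: rk1 f g x.
Proof.
by move=> lB; rewrite /rk1 (linear_atZ _ _ lB) dotZl mulrC -scalerA.
Qed.

(** If [A x <> 0], then [B = rk1 x (A x)] makes [ABA] a nonzero operator with range
    spanned by [A x]; an [A] recovered from this [ABA] has that range too.  The
    adjoint of [A] then provides the second factor. *)
Lemma triple_minimalP S A : star_algebra S -> S A ->
  triple_minimal S A <-> exists f g, [/\ f != 0, g != 0 & A = rk1 f g].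
Proof.
move=> SS SA; have lA := sa_linear SS SA; split.
- move=> [A0 hA].
  have [x Ax0] : exists x, A x != 0.
    apply: contrapT => nx; apply: A0; apply/funext => x.
    by apply: contrapT => /eqP Ax; apply: nx; exists x.
  have [ABA0|[X SX defA]] := hA _ (sa_rk1 SS x (A x)).
    have := congr1 (@^~ x) ABA0; rewrite /rk1 /= (linear_atZ _ _ lA) => /eqP.
    by rewrite scaler_eq0 dnorm_eq0 (negPf Ax0).
  have [B SB AB] := sa_adj SS SA.
  have lB := adjoint_pair_linear (adjoint_pair_sym AB).
  have [psi Apsi] : exists psi : V -> C, forall y, A y = psi y *: A x.
    exists (fun y => '[A (X (A (rk1 x (A x) (A y)))), A x]) => y.
    by rewrite [in LHS]defA /rk1 (linear_atZ _ _ lA).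
  have nAx : '[A x, A x] != 0 by rewrite dnorm_eq0.
  have defAy y : A y = '[y, B (A x)] / '[A x, A x] *: A x.
    by rewrite -AB Apsi dotZl mulfK.
  exists (A x), ('[A x, A x]^-1 *: B (A x)).
  suff defA' : A = rk1 (A x) ('[A x, A x]^-1 *: B (A x)).
    by move: A0; rewrite {1}defA' => /rk1_neq0P[].
  by apply/funext => y; rewrite {1}defAy /rk1 dotZr fmorphV /= -dotC mulrC.
- move=> [f [g [f0 g0 ->]]]; split; first exact: rk1_neq0.
  move=> B SB; have lB := sa_linear SS SB.
  have [Bfg|Bfg] := eqVneq '[B f, g] 0.
    by left; apply/funext => x; rewrite rk1_sandwich // Bfg scale0r.
  right.
  set c := ('[B f, g] * '[g, g] * '[f, f] * '[B f, g])^-1.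
  (* [A (rk1 g f) A = <g, g> <f, f> A]; the rest of [c] undoes the two factors
     [<B f, g>]. *)
  exists (rk1 (c *: g) f); first exact: (sa_rk1 SS).
  apply/funext => x; rewrite !(rk1_sandwich _ _ _ lB).
  rewrite (linear_atZ _ _ (@rk1_linear (c *: g) f)).
  rewrite (linear_atZ _ _ (@rk1_linear f g)) /rk1 !dotZl !scalerA.
  congr (_ *: _); rewrite {}/c; field.
  by rewrite Bfg !dnorm_eq0 f0 g0.
Qed.

Record jordan_triple_bij (SA SB : set (V -> V)) (phi : (V -> V) -> (V -> V)) :
    Prop := {
  jt_bij : set_bij SA SB phi ;
  jt_triple : forall A B, SA A -> SA B ->
    phi (fun x => A (B (A x))) = (fun x => phi A (phi B (phi A x)))
}.

(** Reading [<B f, g>] as the trace of the product of [rk1 f g] and [B]: [phi] acts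
    on these traces through the scalar function [m]. *)
Definition transported (S : set (V -> V)) (phi : (V -> V) -> (V -> V))
    (m : C -> C) f g :=
  forall f' g', phi (rk1 f g) = rk1 f' g' ->
  forall B, S B -> '[phi B f', g'] = m '[B f, g].

End PreHilbert.

(** * Bijections preserving the triple product act on traces by one scalar function *)

Section JordanTriple.
Context {C : numClosedFieldType} {V : lmodType C} (form : {dot V for Num.conj}).
Local Notation "''[' u , v ]" := (form u%R v%R) : ring_scope.
Local Notation rk1 := (rk1 form).
Context {SA SB : set (V -> V)} (SAs : star_algebra form SA)
  (SBs : star_algebra form SB).
Implicit Types (e f g u v w x y : V) (A B : V -> V).

Context {phi : (V -> V) -> (V -> V)} (jphi : jordan_triple_bij SA SB phi).

Lemma jt_im A : SA A -> SB (phi A).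
Proof. by have [h _ _] := jt_bij jphi; exact: h. Qed.

Lemma jt_inj A B : SA A -> SA B -> phi A = phi B -> A = B.
Proof.
by have [_ h _] := jt_bij jphi => hA hB; apply: h; rewrite in_setE.
Qed.

Lemma jt_surj B : SB B -> exists2 A, SA A & phi A = B.
Proof. by have [_ _ h] := jt_bij jphi => /h. Qed.

(** [0 B 0 = 0] with [phi B = 0]. *)
Lemma jt_zero : phi (fun=> 0) = (fun=> 0).
Proof.
have [B SB' phiB] := jt_surj (sa_zero SBs).
have := jt_triple jphi (sa_zero SAs) SB'; rewrite phiB => ->.
apply/funext => x.
exact: linear_at0 (sa_linear SBs (jt_im (sa_zero SAs))).
Qed.

Lemma jt_eq0 A : SA A -> phi A = (fun=> 0) -> A = (fun=> 0).
Proof.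
by move=> hA A0; apply: jt_inj => //; [exact: sa_zero SAs | rewrite jt_zero].
Qed.

Let sa_sandwich S A B : star_algebra form S -> S A -> S B ->
  S (fun x => A (B (A x))).
Proof. by move=> SS hA hB; exact: (sa_mul SS hA (sa_mul SS hB hA)). Qed.

Lemma jt_triple_minimal A : SA A -> triple_minimal SA A <-> triple_minimal SB (phi A).
Proof.
move=> hA; split=> -[A0 hAA]; split.
- by move=> /(jt_eq0 hA).
- move=> _ /jt_surj[B hB <-]; have [ABA|[X hX AX]] := hAA _ hB.
    by left; rewrite -(jt_triple jphi hA hB) ABA jt_zero.
  right; exists (phi X); first exact: jt_im.
  have hABA := sa_sandwich SAs hA hB.
  by rewrite {1}AX (jt_triple jphi hABA hX) (jt_triple jphi hA hB).
- by move=> A0'; apply: A0; rewrite A0' jt_zero.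
- move=> B hB; have hABA := sa_sandwich SAs hA hB.
  have [ABA|[X' hX' AX]] := hAA _ (jt_im hB).
    by left; apply: (jt_eq0 hABA); rewrite (jt_triple jphi hA hB).
  have [X hX defX] := jt_surj hX'; right; exists X => //.
  apply: jt_inj => //; first exact: (sa_sandwich SAs hABA hX).
  by rewrite (jt_triple jphi hABA hX) (jt_triple jphi hA hB) defX.
Qed.

Lemma jt_rk1 f g : f != 0 -> g != 0 ->
  exists f' g', [/\ f' != 0, g' != 0 & phi (rk1 f g) = rk1 f' g'].
Proof.
move=> f0 g0; have hA := sa_rk1 SAs f g.
by apply/(triple_minimalP SBs (jt_im hA))/jt_triple_minimal => //; apply/(triple_minimalP SAs hA); exists f, g.
Qed.

Lemma jt_rk1_surj f' g' : f' != 0 -> g' != 0 ->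
  exists f g, [/\ f != 0, g != 0 & phi (rk1 f g) = rk1 f' g'].
Proof.
move=> f0 g0; have hA' := sa_rk1 SBs f' g'.
have [A hA defA] := jt_surj hA'.
have /(jt_triple_minimal hA)/(triple_minimalP SAs hA)[f [g [? ? defA']]] : triple_minimal SB (phi A).
  by rewrite defA; apply/(triple_minimalP SBs hA'); exists f', g'.
by exists f, g; split=> //; rewrite -defA'.
Qed.

(** This is [phi(ABA) = phi(A) phi(B) phi(A)] for [A = rk1 f g], where both triple
    products are scalar multiples of a rank-one operator. *)
Lemma jt_rk1Z f g f' g' B : phi (rk1 f g) = rk1 f' g' -> SA B ->
  phi (fun x => '[B f, g] *: rk1 f g x) = (fun x => '[phi B f', g'] *: rk1 f' g' x).
Proof.
move=> fg hB; have hA := sa_rk1 SAs f g.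
have lB := sa_linear SAs hB; have lB' := sa_linear SBs (jt_im hB).
have -> : (fun x => '[B f, g] *: rk1 f g x) = (fun x => rk1 f g (B (rk1 f g x))).
  by apply/funext => x; rewrite rk1_sandwich.
by rewrite (jt_triple jphi hA hB) fg; apply/funext => x; rewrite rk1_sandwich.
Qed.

Lemma rk1_scale_inj f g (a b : C) : f != 0 -> g != 0 ->
  (fun x => a *: rk1 f g x) = (fun x => b *: rk1 f g x) -> a = b.
Proof.
move=> f0 g0 /(congr1 (@^~ g))/eqP; rewrite -subr_eq0 -scalerBl /rk1 !scaler_eq0.
by rewrite dnorm_eq0 (negPf f0) (negPf g0) !orbF subr_eq0 => /eqP.
Qed.

Lemma rk1_pairing_onto f g (a : C) : f != 0 -> g != 0 ->
  exists2 B, SA B & '[B f, g] = a.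
Proof.
move=> f0 g0; exists (rk1 ((a / '[f, f] / '[g, g]) *: g) f); first exact: sa_rk1 SAs _ _.
by rewrite /rk1 !dotZl; field; rewrite !dnorm_eq0 f0 g0.
Qed.

(** The operators [B] with a given [<B f, g>] all yield the same [ABA], hence the
    same [<phi(B) f', g'>]. *)
Lemma transported_exists f g : f != 0 -> g != 0 ->
  exists m, transported form SA phi m f g.
Proof.
move=> f0 g0; have [f1 [g1 [f10 g10 fg1]]] := jt_rk1 f0 g0.
have hB (a : C) := cid2 (@rk1_pairing_onto f g a f0 g0).
exists (fun a => '[phi (projT1 (hB a)) f1, g1]) => f' g' fg B SAB.
have [f'0 g'0] : f' != 0 /\ g' != 0.
  by apply: (@rk1_neq0P _ _ form); rewrite -fg fg1; exact: rk1_neq0.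
have hB' := jt_rk1Z fg1 SAB; have := jt_rk1Z fg SAB; rewrite hB' -fg1 fg.
move=> /(rk1_scale_inj f'0 g'0) <-.
case: (hB _) => B1 /= SB1 B1fg; have := jt_rk1Z fg1 SB1; rewrite B1fg hB'.
by move=> /(rk1_scale_inj f10 g10).
Qed.

Lemma transportedZ m f g a : f != 0 -> g != 0 -> transported form SA phi m f g ->
  phi (fun x => a *: rk1 f g x) = (fun x => m a *: phi (rk1 f g) x).
Proof.
move=> f0 g0 mfg; have [f' [g' [f'0 g'0 fg]]] := jt_rk1 f0 g0.
have [B hB <-] := @rk1_pairing_onto f g a f0 g0.
by rewrite -(mfg _ _ fg) // (jt_rk1Z fg hB) fg.
Qed.

Lemma transported1 m f g : f != 0 -> g != 0 -> transported form SA phi m f g -> m 1 = 1.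
Proof.
move=> f0 g0 mfg; have [f' [g' [f'0 g'0 fg]]] := jt_rk1 f0 g0.
have := @transportedZ m f g 1 f0 g0 mfg; rewrite fg.
have -> : (fun x => 1 *: rk1 f g x) = rk1 f g by apply/funext => x; rewrite scale1r.
move=> h; apply: (rk1_scale_inj f'0 g'0); rewrite -h fg.
by apply/funext => x; rewrite scale1r.
Qed.

(** Computing [phi((cA) B (cA))] in two ways gives [m (c^2 d) = m(c)^2 m(d)]; every
    scalar is a square. *)
Lemma transportedM m f g a b : f != 0 -> g != 0 -> transported form SA phi m f g ->
  m (a * b) = m a * m b.
Proof.
move=> f0 g0 mfg; have [f' [g' [f'0 g'0 fg]]] := jt_rk1 f0 g0.
have m1 := transported1 f0 g0 mfg.
have sq c d : m (c ^+ 2 * d) = m c ^+ 2 * m d.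
  have [B hB defd] := @rk1_pairing_onto f g d f0 g0.
  have hA := sa_rk1 SAs f g; have hcA := sa_scale SAs c hA.
  have lB := sa_linear SAs hB; have lB' := sa_linear SBs (jt_im hB).
  have := jt_triple jphi hcA hB; rewrite (transportedZ _ f0 g0 mfg) fg.
  have -> : (fun x => c *: rk1 f g (B (c *: rk1 f g x)))
      = (fun x => (c ^+ 2 * d) *: rk1 f g x).
    apply/funext => x; rewrite (linear_atZ _ _ lB).
    rewrite (linear_atZ _ _ (@rk1_linear _ _ form f g)) rk1_sandwich // defd !scalerA.
    by congr (_ *: _); ring.
  rewrite (transportedZ _ f0 g0 mfg) fg => h; apply: (rk1_scale_inj f'0 g'0); rewrite h.
  apply/funext => x; rewrite (linear_atZ _ _ lB').
  rewrite (linear_atZ _ _ (@rk1_linear _ _ form f' g')) rk1_sandwich //.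
  by rewrite (mfg _ _ fg) // defd !scalerA; congr (_ *: _); ring.
have sq1 c : m (c ^+ 2) = m c ^+ 2 by have := sq c 1; rewrite m1 !mulr1.
by rewrite -(sqrtCK a) sq sq1.
Qed.

(** Both [m] and [n] appear when [phi(B (aA) B)] is computed for [A = rk1 f g] and
    [B = rk1 u v], and [BAB] is a nonzero multiple of [B]. *)
Lemma transported_link m n f g u v : f != 0 -> g != 0 -> u != 0 -> v != 0 ->
  transported form SA phi m f g -> transported form SA phi n u v ->
  '[u, g] * '[f, v] != 0 -> m =1 n.
Proof.
move=> f0 g0 u0 v0 mfg nuv fguv a.
have [f' [g' [f'0 g'0 fg]]] := jt_rk1 f0 g0.
have [u' [v' [u'0 v'0 uv]]] := jt_rk1 u0 v0.
have hA := sa_rk1 SAs f g; have hB := sa_rk1 SAs u v; have hcA := sa_scale SAs a hA.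
set t := '[u, g] * '[f, v] in fguv.
have nM := transportedM _ _ u0 v0 nuv.
have nt : n t != 0.
  apply/eqP => nt0; have := nM t t^-1; rewrite divff // (transported1 u0 v0 nuv) nt0 mul0r.
  by apply/eqP; rewrite oner_eq0.
have tE : '[rk1 f g u, v] = t by rewrite /rk1 dotZl.
apply: (mulIf nt); rewrite -nM.
apply: (rk1_scale_inj u'0 v'0); rewrite -uv -(transportedZ _ u0 v0 nuv).
have -> : (fun x => (a * t) *: rk1 u v x) = (fun x => rk1 u v (a *: rk1 f g (rk1 u v x))).
  apply/funext => x; rewrite (linear_atZ _ _ (@rk1_linear _ _ form u v)).
  by rewrite (rk1_sandwich _ _ _ _ (@rk1_linear _ _ form f g)) tE -scalerA.
have -> : phi (fun x => rk1 u v (a *: rk1 f g (rk1 u v x))) = _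
  := jt_triple jphi hB hcA.
rewrite (transportedZ _ f0 g0 mfg) fg uv.
have lA' := @rk1_linear _ _ form f' g'.
apply/funext => x; rewrite (linear_atZ _ _ (@rk1_linear _ _ form u' v')).
by rewrite rk1_sandwich // -fg (nuv _ _ uv) // tE -scalerA.
Qed.

Lemma pair_nonorth u v : u != 0 -> v != 0 -> exists w, '[w, u] != 0 /\ '[w, v] != 0.
Proof.
move=> u0 v0; have [uv|] := eqVneq '[u, v] 0; last first.
  by exists u; rewrite dnorm_eq0 u0.
exists (u + v); rewrite !dotDl uv add0r dnorm_eq0 v0.
by rewrite (dotC form v u) uv rmorph0 addr0 dnorm_eq0.
Qed.

(** Any two rank-one operators are linked, in the sense of [transported_link], by a
    third one. *)
Lemma transported_uniform e : e != 0 -> exists mu : C -> C,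
  forall f g, f != 0 -> g != 0 -> transported form SA phi mu f g.
Proof.
move=> e0; have [mu mue] := transported_exists e0 e0; exists mu => f g f0 g0.
have [m mfg] := transported_exists f0 g0.
have [u [ug ue]] := pair_nonorth g0 e0.
have [v [vf ve]] := pair_nonorth f0 e0.
have u0 : u != 0 by apply: contraNneq ug => ->; rewrite dot0l.
have v0 : v != 0 by apply: contraNneq vf => ->; rewrite dot0l.
have [n nuv] := transported_exists u0 v0.
have fv : '[f, v] != 0 by rewrite dotC fmorph_eq0.
have ev : '[e, v] != 0 by rewrite dotC fmorph_eq0.
have mn := transported_link f0 g0 u0 v0 mfg nuv (mulf_neq0 ug fv).
have en := transported_link e0 e0 u0 v0 mue nuv (mulf_neq0 ue ev).
by move=> f' g' fg B hB; rewrite en -mn; exact: mfg.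
Qed.

End JordanTriple.

(** * The scalar function is a ring automorphism, and the bijection is semilinear *)

Section Additivity.
Context {C : numClosedFieldType} {V : lmodType C} (form : {dot V for Num.conj}).
Local Notation "''[' u , v ]" := (form u%R v%R) : ring_scope.
Local Notation rk1 := (rk1 form).
Context {SA SB : set (V -> V)} (SAs : star_algebra form SA)
  (SBs : star_algebra form SB).
Context {phi : (V -> V) -> (V -> V)} (jphi : jordan_triple_bij SA SB phi).
Implicit Types (f g u v w x y : V) (A B : V -> V).
Context {e0 e1 : V} (e00 : '[e0, e0] = 1) (e11 : '[e1, e1] = 1) (e01 : '[e0, e1] = 0).
Context {mu : C -> C} (mu_tr : forall f g, f != 0 -> g != 0 ->
  transported form SA phi mu f g).

Let e10 : '[e1, e0] = 0. Proof. by rewrite dotC e01 rmorph0. Qed.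
Let e0_neq0 : e0 != 0. Proof. by rewrite -(dnorm_eq0 form) e00 oner_eq0. Qed.
Let e1_neq0 : e1 != 0. Proof. by rewrite -(dnorm_eq0 form) e11 oner_eq0. Qed.
Let e0D1_neq0 : e0 + e1 != 0.
Proof.
apply/eqP => /(congr1 (form^~ e0)); rewrite dotDl e00 e10 dot0l addr0.
by apply/eqP; rewrite oner_eq0.
Qed.

Lemma mu_zero : mu 0 = 0.
Proof.
have [f' [g' [f'0 g'0 fg]]] := jt_rk1 SAs SBs jphi e0_neq0 e0_neq0.
have := mu_tr e0_neq0 e0_neq0 fg (sa_zero SAs).
by rewrite (jt_zero SAs SBs jphi) !dot0l.
Qed.

Lemma mu_one : mu 1 = 1.
Proof. exact: (transported1 SAs SBs jphi _ _ (mu_tr e0_neq0 e0_neq0)). Qed.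

Lemma mu_mul a b : mu (a * b) = mu a * mu b.
Proof. exact: (transportedM SAs SBs jphi _ _ _ _ (mu_tr e0_neq0 e0_neq0)). Qed.

Lemma mu_eq0 a : mu a = 0 -> a = 0.
Proof.
have [f' [g' [f'0 g'0 fg]]] := jt_rk1 SAs SBs jphi e0_neq0 e0_neq0.
have hA := sa_rk1 SAs e0 e0; have haA := sa_scale SAs a hA.
move=> mua; have := transportedZ SAs SBs jphi a e0_neq0 e0_neq0 (mu_tr e0_neq0 e0_neq0).
rewrite mua => h.
have /(congr1 (@^~ e0))/eqP : (fun x => a *: rk1 e0 e0 x) = (fun=> 0).
  apply: (jt_eq0 SAs SBs jphi haA); rewrite h.
  by apply/funext => x; rewrite scale0r.
by rewrite /rk1 e00 scale1r scaler_eq0 (negPf e0_neq0) orbF => /eqP.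
Qed.

Lemma mu_surj b : exists a, mu a = b.
Proof.
have [f' [g' [f'0 g'0 fg]]] := jt_rk1 SAs SBs jphi e0_neq0 e0_neq0.
have [B' hB' <-] := rk1_pairing_onto SBs b f'0 g'0.
have [B hB <-] := jt_surj jphi hB'.
by exists '[B e0, e0]; rewrite (mu_tr e0_neq0 e0_neq0 fg hB).
Qed.

(** The forms [p], [q], [r] below are the pairings with the images of [rk1 e0 e0],
    [rk1 e0 e1] and [rk1 e0 (e0 + e1)].  Subtracting from [phi B] the right
    combination of [phi B1] and [phi B2] gives an operator killed by [p] and [q];
    it is some [phi N], so [N] is killed by the two original pairings, hence by
    the third, and [phi N] is killed by [r]. *)
Lemma mu_add a b : mu (a + b) = mu a + mu b.
Proof.
have [f1 [g1 [_ _ fg1]]] := jt_rk1 SAs SBs jphi e0_neq0 e0_neq0.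
have [f2 [g2 [_ _ fg2]]] := jt_rk1 SAs SBs jphi e0_neq0 e1_neq0.
have [f3 [g3 [_ _ fg3]]] := jt_rk1 SAs SBs jphi e0_neq0 e0D1_neq0.
have p B (hB : SA B) := mu_tr e0_neq0 e0_neq0 fg1 hB.
have q B (hB : SA B) := mu_tr e0_neq0 e1_neq0 fg2 hB.
have r B (hB : SA B) := mu_tr e0_neq0 e0D1_neq0 fg3 hB.
pose B1 := rk1 e0 e0; pose B2 := rk1 e1 e0; pose B := rk1 (a *: e0 + b *: e1) e0.
have hB1 : SA B1 := sa_rk1 SAs _ _; have hB2 : SA B2 := sa_rk1 SAs _ _.
have hB : SA B := sa_rk1 SAs _ _.
have hN' := sa_add SBs (jt_im jphi hB) (sa_add SBs
   (sa_scale SBs (- mu a) (jt_im jphi hB1)) (sa_scale SBs (- mu b) (jt_im jphi hB2))).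
have [N hN NE] := jt_surj jphi hN'.
have N0 : '[N e0, e0] = 0.
  apply: mu_eq0; rewrite -(p _ hN) NE !dotDl !dotZl !p // /B /B1 /B2 /rk1.
  by rewrite e00 !scale1r dotDl !dotZl e00 e10 mu_zero mulr0 mulr1 addr0 mu_one; ring.
have N1 : '[N e0, e1] = 0.
  apply: mu_eq0; rewrite -(q _ hN) NE !dotDl !dotZl !q // /B /B1 /B2 /rk1.
  by rewrite e00 !scale1r dotDl !dotZl e01 e11 mu_zero !mulr0 mulr1 add0r mu_one; ring.
have := r _ hN; rewrite dotDr N0 N1 addr0 mu_zero NE !dotDl !dotZl !r //.
rewrite /B /B1 /B2 /rk1 e00 !scale1r !dotDr !dotDl !dotZl e00 e01 e10 e11.
rewrite !(mulr0, mulr1, addr0, add0r) mu_one !mulr1 => h.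
by apply/eqP; rewrite -subr_eq0; apply/eqP; rewrite -[RHS]h; ring.
Qed.

(** Pairings with rank-one operators separate operators, and all rank-one operators
    in the target are images. *)
Lemma phi_semilinear a A B : SA A -> SA B ->
  phi (fun x => a *: A x + B x) = (fun x => mu a *: phi A x + phi B x).
Proof.
move=> hA hB; have haA := sa_scale SAs a hA; have hS := sa_add SAs haA hB.
apply/funext => f'; have [->|f'0] := eqVneq f' 0.
  have l0 X : SA X -> phi X 0 = 0.
    by move=> hX; exact/linear_at0/(sa_linear SBs)/(jt_im jphi).
  by rewrite !l0 // scaler0 addr0.
apply: (dot_ext (form := form)) => g'.
have [->|g'0] := eqVneq g' 0; first by rewrite !dot0r.
have [f [g [f0 g0 fg]]] := jt_rk1_surj SAs SBs jphi f'0 g'0.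
have tr := mu_tr f0 g0 fg.
by rewrite dotDl dotZl !tr // dotDl dotZl mu_add mu_mul.
Qed.

End Additivity.

(** * Additive families of operators of rank at most one *)

Section Cliques.
Context {C : numClosedFieldType} {V : lmodType C} (form : {dot V for Num.conj}).
Local Notation "''[' u , v ]" := (form u%R v%R) : ring_scope.
Local Notation rk1 := (rk1 form).
Implicit Types (a b f g u v w x y z : V).

Lemma rk1Zr (c : C) f g : rk1 f (c *: g) = rk1 (Num.conj c *: f) g.
Proof. by apply/funext => x; rewrite /rk1 dotZr scalerA mulrC. Qed.

Lemma rk1Dr f g h : rk1 f (g + h) = (fun x => rk1 f g x + rk1 f h x).
Proof. by apply/funext => x; rewrite /rk1 dotDr scalerDl. Qed.

Lemma rk1Dl f g h : rk1 (f + h) g = (fun x => rk1 f g x + rk1 h g x).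
Proof. by apply/funext => x; rewrite /rk1 scalerDr. Qed.

Lemma rk1_injl f g h : g != 0 -> rk1 f g = rk1 h g -> f = h.
Proof.
move=> g0 /(congr1 (@^~ g)); rewrite /rk1; apply: scalerI.
by rewrite dnorm_eq0.
Qed.

(** If [v] is not a multiple of [b], some [d] is orthogonal to [b] but not to [v]:
    evaluation at [d] puts [u] on the line of [w], and then evaluation at [b] puts
    [a] there. *)
Lemma rk1_addP a b u v w z : a != 0 -> b != 0 ->
  (fun x => rk1 a b x + rk1 u v x) = rk1 w z ->
  (exists c, u = c *: a) \/ (exists c, v = c *: b).
Proof.
move=> a0 b0 abuv.
have b2 : '[b, b] != 0 by rewrite dnorm_eq0.
pose d := v - ('[v, b] / '[b, b]) *: b.
have [d0|d0] := eqVneq d 0.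
  by right; exists ('[v, b] / '[b, b]); apply/eqP; rewrite -subr_eq0 -/d d0.
left; have db : '[d, b] = 0 by rewrite /d dotBl dotZl divfK // subrr.
have dv : '[d, v] = '[d, d].
  by rewrite {3}/d dotDr -scaleNr dotZr db mulr0 addr0.
have d2 : '[d, d] != 0 by rewrite dnorm_eq0.
have uw : u = ('[d, z] / '[d, d]) *: w.
  have := congr1 (@^~ d) abuv; rewrite /rk1 db scale0r add0r dv => uw.
  by rewrite mulrC -scalerA -uw scalerA mulVf // scale1r.
have [k aw] : exists k, a = k *: w.
  have := congr1 (@^~ b) abuv; rewrite /rk1 uw scalerA => /eqP.
  rewrite eq_sym -subr_eq -scalerBl => /eqP aw.
  by eexists; rewrite -[LHS](scalerK b2) -aw scalerA.
have k0 : k != 0 by apply: contraNneq a0 => k0; rewrite aw k0 scale0r.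
by eexists; rewrite uw -[w in LHS](scalerK k0) -aw scalerA.
Qed.

(** Each [F x] shares a factor with [F e], by [rk1_addP].  The [x] for which it is
    the left one and those for which it is the right one form two additive
    subgroups with union [V], and a group is never the union of two proper
    subgroups. *)
Lemma additive_rk1_family (F : V -> V -> V) e a b : a != 0 -> b != 0 ->
  F e = rk1 a b -> (forall x y, F (x + y) = (fun z => F x z + F y z)) ->
  (forall x, exists u v, F x = rk1 u v) ->
  (forall x, exists s, F x = rk1 a s) \/ (forall x, exists s, F x = rk1 s b).
Proof.
move=> a0 b0 Fe FD Frk.
have or x : (exists s, F x = rk1 a s) \/ (exists s, F x = rk1 s b).
  have [u [v Fx]] := Frk x; have [w [z Fex]] := Frk (e + x).
  have := FD e x; rewrite Fex Fe Fx => /esym /(rk1_addP a0 b0) [[c ->]|[c ->]].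
    by left; exists (Num.conj c *: v); rewrite rk1Zr conjCK.
  by right; exists (Num.conj c *: u); rewrite rk1Zr.
have [|/existsNP[x Nx]] := pselect (forall x, exists s, F x = rk1 a s); first by left.
right => y; have [[s Fy]|//] := or y.
have [[s' Fx]|[s' Fx]] := or x; first by case: Nx; exists s'.
have [[t Fxy]|[t Fxy]] := or (x + y).
  case: Nx; exists (t - s); apply/funext => z.
  have := congr1 (@^~ z) (FD x y); rewrite Fxy Fy => /eqP.
  rewrite -subr_eq => /eqP <-.
  by rewrite /rk1 -scalerBl -dotBr.
exists (t - s'); apply/funext => z.
have := congr1 (@^~ z) (FD x y); rewrite Fxy Fx addrC => /eqP.
rewrite -subr_eq => /eqP <-.
by rewrite /rk1 -scalerBr.
Qed.

End Cliques.

(** * Implementation by a semilinear bijection *)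

Section Implementation.
Context {C : numClosedFieldType} {V : lmodType C} (form : {dot V for Num.conj}).
Local Notation "''[' u , v ]" := (form u%R v%R) : ring_scope.
Local Notation rk1 := (rk1 form).
Context {SA SB : set (V -> V)} (SAs : star_algebra form SA)
  (SBs : star_algebra form SB).
Context {phi : (V -> V) -> (V -> V)} (jphi : jordan_triple_bij SA SB phi).
Implicit Types (f g u v w x y : V) (A B : V -> V).
Context {e0 e1 : V} (e00 : '[e0, e0] = 1) (e11 : '[e1, e1] = 1) (e01 : '[e0, e1] = 0).
Context {mu : C -> C} (mu_tr : forall f g, f != 0 -> g != 0 ->
  transported form SA phi mu f g).

Let e10 : '[e1, e0] = 0. Proof. by rewrite dotC e01 rmorph0. Qed.
Let e0_neq0 : e0 != 0. Proof. by rewrite -(dnorm_eq0 form) e00 oner_eq0. Qed.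
Let e1_neq0 : e1 != 0. Proof. by rewrite -(dnorm_eq0 form) e11 oner_eq0. Qed.

Let mu0 := mu_zero SAs SBs jphi e00 mu_tr.
Let mu1 := mu_one SAs SBs jphi e00 mu_tr.
Let muM := mu_mul SAs SBs jphi e00 mu_tr.
Let muI := mu_eq0 SAs SBs jphi e00 mu_tr.
Let muS := mu_surj SAs SBs jphi e00 mu_tr.
Let phiL := phi_semilinear SAs SBs jphi e00 e11 e01 mu_tr.

Lemma phi_add A B : SA A -> SA B ->
  phi (fun x => A x + B x) = (fun x => phi A x + phi B x).
Proof.
move=> hA hB; have := phiL 1 hA hB; rewrite mu1.
have -> : (fun x => 1 *: A x + B x) = (fun x => A x + B x).
  by apply/funext => x; rewrite scale1r.
by move=> ->; apply/funext => x; rewrite scale1r.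
Qed.

Lemma phi_triple_polarized A B D : SA A -> SA B -> SA D ->
  phi (fun x => A (B (D x)) + D (B (A x)))
  = (fun x => phi A (phi B (phi D x)) + phi D (phi B (phi A x))).
Proof.
move=> hA hB hD; have hAD := sa_add SAs hA hD.
have m3 X Y Z (hX : SA X) (hY : SA Y) (hZ : SA Z) : SA (fun x => X (Y (Z x))).
  exact: (sa_mul SAs hX (sa_mul SAs hY hZ)).
have lB := sa_linear SAs hB; have lA := sa_linear SAs hA; have lD := sa_linear SAs hD.
have lB' := sa_linear SBs (jt_im jphi hB).
have lA' := sa_linear SBs (jt_im jphi hA).
have lD' := sa_linear SBs (jt_im jphi hD).
have : phi (fun x => A (B (A x + D x)) + D (B (A x + D x))) = _
  := jt_triple jphi hAD hB.
rewrite (phi_add hA hD).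
have -> : (fun x => A (B (A x + D x)) + D (B (A x + D x)))
   = (fun x => (A (B (A x)) + D (B (D x))) + (A (B (D x)) + D (B (A x)))).
  apply/funext => x; rewrite !(linear_atD _ _ lB, linear_atD _ _ lA, linear_atD _ _ lD).
  by rewrite [in LHS](addrC (D _)) addrACA.
rewrite (@phi_add _ _ (sa_add SAs (m3 _ _ _ hA hB hA) (m3 _ _ _ hD hB hD))
  (sa_add SAs (m3 _ _ _ hA hB hD) (m3 _ _ _ hD hB hA))).
rewrite (phi_add (m3 _ _ _ hA hB hA) (m3 _ _ _ hD hB hD))
  (jt_triple jphi hA hB) (jt_triple jphi hD hB) => h.
apply/funext => x; have /= := congr1 (@^~ x) h.
rewrite !(linear_atD _ _ lB', linear_atD _ _ lA', linear_atD _ _ lD') => h'.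
apply: (addrI (phi A (phi B (phi A x)) + phi D (phi B (phi D x)))).
by rewrite {}h' (addrC (phi D (phi B (phi A x)))) addrACA.
Qed.

Lemma phi_rk1_rk1 f g : exists u v, phi (rk1 f g) = rk1 u v.
Proof.
have [/rk1_neq0P[f0 g0]|] := pselect (rk1 f g <> (fun=> 0)).
  by have [u [v [_ _ uv]]] := jt_rk1 SAs SBs jphi f0 g0; exists u, v.
move=> /contrapT ->; exists 0, 0; rewrite (jt_zero SAs SBs jphi).
by apply/funext => x; rewrite /rk1 scaler0.
Qed.

(** The two cases are those of an isomorphism and of an antiisomorphism. *)
Lemma phi_rk1_dichotomy a b : phi (rk1 e0 e0) = rk1 a b ->
  ((forall y, exists s, phi (rk1 e0 y) = rk1 a s) /\
   (forall x, exists s, phi (rk1 x e0) = rk1 s b)) \/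
  ((forall y, exists s, phi (rk1 e0 y) = rk1 s b) /\
   (forall x, exists s, phi (rk1 x e0) = rk1 a s)).
Proof.
move=> eab.
have [a0 b0] : a != 0 /\ b != 0.
  apply: (@rk1_neq0P _ _ form); rewrite -eab => /(jt_eq0 SAs SBs jphi (sa_rk1 SAs _ _)).
  exact: rk1_neq0.
have rows := additive_rk1_family (F := fun y => phi (rk1 e0 y)) a0 b0 eab.
have cols := additive_rk1_family (F := fun x => phi (rk1 x e0)) a0 b0 eab.
have {rows} : (forall y, exists s, phi (rk1 e0 y) = rk1 a s) \/
   (forall y, exists s, phi (rk1 e0 y) = rk1 s b).
  apply: rows => [x y|x]; last exact: phi_rk1_rk1.
  by rewrite rk1Dr phi_add //; exact: sa_rk1 SAs _ _.
have {cols} : (forall x, exists s, phi (rk1 x e0) = rk1 a s) \/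
   (forall x, exists s, phi (rk1 x e0) = rk1 s b).
  apply: cols => [x y|x]; last exact: phi_rk1_rk1.
  by rewrite rk1Dl phi_add //; exact: sa_rk1 SAs _ _.
(* If rows and columns shared the same factor, the image of [rk1 e0 e1] would be
   orthogonal to the image of [rk1 e1 e0], since the former squares to zero; but
   their pairing is [mu 1]. *)
have nil s t : phi (rk1 e0 e1) = rk1 s t -> '[s, t] = 0.
  move=> st; have := mu_tr e0_neq0 e1_neq0 st (sa_rk1 SAs e0 e1).
  rewrite st /rk1 !dotZl e01 mul0r mu0 => /eqP.
  by rewrite mulf_eq0 orbb => /eqP.
have pair s t s' t' : phi (rk1 e0 e1) = rk1 s t -> phi (rk1 e1 e0) = rk1 s' t' ->
    '[s, t'] * '[s', t] = 1.
  move=> st st'; have := mu_tr e0_neq0 e1_neq0 st (sa_rk1 SAs e1 e0).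
  by rewrite st' /rk1 !dotZl e00 e11 mulr1 mu1.
case=> cols [] rows; [exfalso|by right|by left|exfalso].
- have [s hs] := rows e1; have [s' hs'] := cols e1.
  have := pair _ _ _ _ hs hs'; rewrite (nil _ _ hs) mulr0 => /eqP.
  by rewrite eq_sym oner_eq0.
- have [s hs] := rows e1; have [s' hs'] := cols e1.
  have := pair _ _ _ _ hs hs'; rewrite (nil _ _ hs) mul0r => /eqP.
  by rewrite eq_sym oner_eq0.
Qed.

(** The polarized triple identity for [rk1 x e0], [rk1 e0 e0], [rk1 e0 y] determines
    [phi] on [rk1 x y].  The existence of the vectors [z] and [y] in the conclusion
    says that [T] has a [mu]-twisted adjoint which is onto. *)
Lemma phi_implemented a b : '[a, b] = 1 -> phi (rk1 e0 e0) = rk1 a b ->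
  (forall y, exists s, phi (rk1 e0 y) = rk1 a s) ->
  (forall x, exists s, phi (rk1 x e0) = rk1 s b) ->
  exists T Tinv : V -> V,
   [/\ cancel T Tinv /\ cancel Tinv T,
       forall c x y, T (c *: x + y) = mu c *: T x + T y,
       forall y, exists z, forall x, '[T x, z] = mu '[x, y],
       forall z, exists y, forall x, '[T x, z] = mu '[x, y] &
       forall A, SA A -> phi A = (fun x => T (A (Tinv x)))].
Proof.
move=> ab eab /choice[S rowS] /choice[T colT].
have a0 : a != 0.
  by apply: contraTneq isT => a0; move/eqP: ab; rewrite a0 dot0l eq_sym oner_eq0.
have b0 : b != 0.
  by apply: contraTneq isT => b0; move/eqP: ab; rewrite b0 dot0r eq_sym oner_eq0.
have hP := sa_rk1 SAs e0 e0.
have TL c x y : T (c *: x + y) = mu c *: T x + T y.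
  apply: (rk1_injl (form := form) b0); rewrite -colT rk1Dl rk1Zl.
  rewrite (phiL c (sa_rk1 SAs x e0) (sa_rk1 SAs y e0)).
  by rewrite !colT rk1Dl rk1Zl.
have T0 : T 0 = 0.
  have /eqP := TL 1 0 0; rewrite scaler0 addr0 mu1 scale1r -subr_eq subrr.
  by move=> /eqP.
have S0 : S 0 = 0.
  apply: (rk1_eq0 (form := form) a0); rewrite -rowS -(jt_zero SAs SBs jphi); congr phi.
  by apply/funext => z; rewrite /rk1 dot0r scale0r.
have Tb x : '[T x, b] = mu '[x, e0].
  have := mu_tr e0_neq0 e0_neq0 eab (sa_rk1 SAs x e0).
  by rewrite colT /rk1 ab e00 !scale1r.
have aS y : '[a, S y] = mu '[e0, y].
  have := mu_tr e0_neq0 e0_neq0 eab (sa_rk1 SAs e0 y).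
  by rewrite rowS /rk1 !dotZl ab e00 !mulr1.
have TS x y : '[T x, S y] = mu '[x, y].
  have [->|y0] := eqVneq y 0; first by rewrite S0 !dot0r mu0.
  have := mu_tr e0_neq0 y0 (rowS y) (sa_rk1 SAs x e0).
  by rewrite colT /rk1 ab e00 !scale1r.
have phi_rk x y : phi (rk1 x y) = rk1 (T x) (S y).
  have hx := sa_rk1 SAs x e0; have hy := sa_rk1 SAs e0 y.
  have := phi_triple_polarized hx hP hy.
  have -> : (fun z => rk1 x e0 (rk1 e0 e0 (rk1 e0 y z))
                    + rk1 e0 y (rk1 e0 e0 (rk1 x e0 z)))
     = (fun z => ('[e0, y] * '[x, e0]) *: rk1 e0 e0 z + rk1 x y z).
    apply/funext => z; rewrite /rk1 !dotZl e00 !mulr1 !scalerA addrC.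
    by congr (_ *: _ + _); ring.
  rewrite phiL //; last exact: sa_rk1 SAs _ _.
  rewrite eab (colT x) (rowS y) => h; apply/funext => z; have := congr1 (@^~ z) h.
  rewrite /rk1 !dotZl ab !mulr1 aS Tb addrC !scalerA muM => h'.
  by apply: (addIr _ (etrans h' _)); congr (_ + _ *: _); ring.
(* The operator [rk1 w b] is an image, so [w] is a multiple of some [T f], and [mu]
   is onto. *)
have Tsurj w : exists x, T x = w.
  have [->|w0] := eqVneq w 0; first by exists 0.
  have [f [g [_ _]]] := jt_rk1_surj SAs SBs jphi w0 b0.
  rewrite phi_rk => /(congr1 (@^~ b)); rewrite /rk1.
  have [c ck] := muS ('[b, S g] / '[b, b]) => h.
  have b2 : '[b, b] != 0 by rewrite dnorm_eq0.
  exists (c *: f); have := TL c f 0; rewrite T0 !addr0 => ->.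
  by rewrite ck mulrC -scalerA h scalerA mulVf // scale1r.
have Tinj x y : T x = T y -> x = y.
  move=> xy; apply/eqP; rewrite -subr_eq0; apply/eqP.
  have Txy0 : T (x - y) = 0.
    have := TL 1 (x - y) y; rewrite scale1r subrK mu1 scale1r xy => /eqP.
    by rewrite -subr_eq subrr eq_sym => /eqP.
  apply: (dot_ext (form := form)) => z; rewrite dot0l; apply: muI.
  by rewrite -TS Txy0 dot0l.
have [Tinv TinvK] := choice Tsurj.
exists T, Tinv; split => //.
- by split=> // x; apply: Tinj; rewrite TinvK.
- by move=> y; exists (S y).
- move=> z; have [->|z0] := eqVneq z 0.
    by exists 0 => x; rewrite !dot0r mu0.
  have [f [g [_ _ fg]]] := jt_rk1_surj SAs SBs jphi a0 z0.
  have a2 : '[a, a] != 0 by rewrite dnorm_eq0.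
  have [c ck] := muS ('[T f, a] / '[a, a]).
  exists (Num.conj c *: g) => x.
  rewrite dotZr conjCK muM ck -TS.
  have := congr1 (fun A => '[A (T x), a]) fg; rewrite phi_rk /rk1 !dotZl => h.
  by apply: (mulIf a2); rewrite -h mulrAC divfK // mulrC.
- move=> A hA; apply/funext => w; have {1}<- := TinvK w; move: (Tinv w) => x.
  have [->|x0] := eqVneq x 0.
    rewrite T0 (linear_at0 (sa_linear SAs hA)) T0.
    exact: linear_at0 (sa_linear SBs (jt_im jphi hA)).
  apply/eqP; rewrite -subr_eq0; apply/eqP.
  have [d dE] := Tsurj (phi A (T x) - T (A x)); rewrite -dE.
  suff -> : d = 0 by [].
  apply: (dot_ext (form := form)) => y; rewrite dot0l; apply: muI.
  rewrite -TS dE dotBl TS.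
  have [->|y0] := eqVneq y 0; first by rewrite S0 !dot0r mu0 subrr.
  by rewrite (mu_tr x0 y0 (phi_rk x y) hA) subrr.
Qed.

End Implementation.

(** * Adjoints, and the form of triple isomorphisms *)

Section Adjoint.
Context {C : numClosedFieldType} {V : lmodType C} (form : {dot V for Num.conj}).
Local Notation "''[' u , v ]" := (form u%R v%R) : ring_scope.
Local Notation rk1 := (rk1 form).
Implicit Types (A B : V -> V) (S : set (V -> V)).

Definition hadj A : V -> V := xget (fun=> 0) [set B | adjoint_pair form A B].

Lemma hadjE A B : adjoint_pair form A B -> hadj A = B.
Proof.
by move=> AB; apply: xget_unique => // B' AB'; exact: adjoint_pair_uniq AB' AB.
Qed.

Lemma sa_hadj S A : star_algebra form S -> S A -> S (hadj A).
Proof. by move=> SS hA; have [B hB /hadjE ->] := sa_adj SS hA. Qed.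

Lemma hadjP S A : star_algebra form S -> S A -> adjoint_pair form A (hadj A).
Proof. by move=> SS hA; have [B hB AB] := sa_adj SS hA; rewrite (hadjE AB). Qed.

Lemma hadjK S A : star_algebra form S -> S A -> hadj (hadj A) = A.
Proof. by move=> SS hA; apply/hadjE/adjoint_pair_sym/(hadjP SS hA). Qed.

Lemma hadj_rk1 f g : hadj (rk1 f g) = rk1 g f.
Proof. by apply: hadjE; exact: rk1_adjoint. Qed.

Lemma hadj_comp S A B : star_algebra form S -> S A -> S B ->
  hadj (fun x => A (B x)) = (fun x => hadj B (hadj A x)).
Proof.
move=> SS hA hB; apply: hadjE => x y.
by rewrite (hadjP SS hA) (hadjP SS hB).
Qed.

Lemma hadj_add S A B : star_algebra form S -> S A -> S B ->
  hadj (fun x => A x + B x) = (fun x => hadj A x + hadj B x).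
Proof.
move=> SS hA hB; apply: hadjE => x y.
by rewrite dotDl dotDr (hadjP SS hA) (hadjP SS hB).
Qed.

Lemma hadj_scale S A (a : C) : star_algebra form S -> S A ->
  hadj (fun x => a *: A x) = (fun x => Num.conj a *: hadj A x).
Proof.
move=> SS hA; apply: hadjE => x y.
by rewrite dotZl dotZr conjCK (hadjP SS hA).
Qed.

End Adjoint.

Section Structure.
Context {C : numClosedFieldType} {V : lmodType C} (form : {dot V for Num.conj}).
Local Notation "''[' u , v ]" := (form u%R v%R) : ring_scope.
Local Notation rk1 := (rk1 form).
Context {SA SB : set (V -> V)} (SAs : star_algebra form SA)
  (SBs : star_algebra form SB).
Implicit Types (A B : V -> V).

Lemma set_bij_sign phi (c : C) : c * c = 1 -> set_bij SA SB phi ->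
  set_bij SA SB (fun A x => c *: phi A x).
Proof.
move=> cc [phi_im phi_inj phi_surj]; split.
- by move=> A /phi_im hA; exact: (sa_scale SBs c hA).
- move=> A B hA hB AB; apply: phi_inj => //.
  apply/funext => x; have := congr1 (fun f => c *: f x) AB.
  by rewrite !scalerA cc !scale1r.
- move=> B hB; have [A hA AB] := phi_surj _ (sa_scale SBs c hB).
  exists A => //; rewrite AB; apply/funext => x.
  by rewrite scalerA cc scale1r.
Qed.

Lemma jordan_triple_sign phi (c : C) : c * c = 1 ->
  jordan_triple_bij SA SB phi ->
  jordan_triple_bij SA SB (fun A x => c *: phi A x).
Proof.
move=> cc jphi; split; first exact: set_bij_sign (jt_bij jphi).
move=> A B hA hB; rewrite (jt_triple jphi hA hB); apply/funext => x /=.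
have lA := sa_linear SBs (jt_im jphi hA); have lB := sa_linear SBs (jt_im jphi hB).
rewrite (linear_atZ _ _ lA) (linear_atZ _ _ lB) (linear_atZ _ _ lA) !scalerA.
by rewrite cc mulr1.
Qed.

Lemma jordan_triple_hadj phi : jordan_triple_bij SA SB phi ->
  jordan_triple_bij SA SB (fun A => phi (hadj form A)).
Proof.
move=> jphi; split; [split|].
- by move=> A hA; exact: (jt_im jphi (sa_hadj SAs hA)).
- move=> A B; rewrite !in_setE => hA hB AB.
  rewrite -(hadjK SAs hA) -(hadjK SAs hB); congr (hadj form _).
  by apply: (jt_inj jphi _ _ AB); exact: sa_hadj.
- move=> B hB; have [A hA AB] := jt_surj jphi hB.
  by exists (hadj form A); [exact: sa_hadj|rewrite (hadjK SAs hA)].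
- move=> A B hA hB; rewrite (hadj_comp SAs hA (sa_mul SAs hB hA)).
  rewrite (hadj_comp SAs hB hA).
  exact: (jt_triple jphi (sa_hadj SAs hA) (sa_hadj SAs hB)).
Qed.

Record adjointable_semilinear (mu : C -> C) (T Tinv : V -> V) : Prop := {
  as_can : cancel T Tinv ;
  as_canV : cancel Tinv T ;
  as_lin : forall c x y, T (c *: x + y) = mu c *: T x + T y ;
  as_dual : forall y, exists z, forall x, '[T x, z] = mu '[x, y] ;
  as_adj : forall z, exists y, forall x, '[T x, z] = mu '[x, y]
}.

Record ring_endo (mu : C -> C) : Prop := {
  re_one : mu 1 = 1 ;
  re_add : forall a b, mu (a + b) = mu a + mu b ;
  re_mul : forall a b, mu (a * b) = mu a * mu b
}.

(** As [rk1 e0 e0] equals its cube, its image [rk1 a b] satisfies [<a, b> ^ 2 = 1];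
    multiplying [phi] by [c = <a, b>] makes the image idempotent.  In the second case
    of [phi_rk1_dichotomy], precomposition with the adjoint, which exchanges
    [rk1 e0 y] and [rk1 y e0], leads back to the first. *)
Theorem jordan_triple_implemented phi e0 e1 :
  jordan_triple_bij SA SB phi ->
  '[e0, e0] = 1 -> '[e1, e1] = 1 -> '[e0, e1] = 0 ->
  exists c mu T Tinv, [/\ c = 1 \/ c = -1, ring_endo mu,
    adjointable_semilinear mu T Tinv &
    (forall A, SA A -> phi A = (fun x => c *: T (A (Tinv x)))) \/
    (forall A, SA A -> phi A = (fun x => c *: T (hadj form A (Tinv x))))].
Proof.
move=> jphi e00 e11 e01.
have e0_neq0 : e0 != 0 by rewrite -(dnorm_eq0 form) e00 oner_eq0.
pose P := rk1 e0 e0; have hP : SA P := sa_rk1 SAs e0 e0.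
have [a [b [a0 b0 Pab]]] := jt_rk1 SAs SBs jphi e0_neq0 e0_neq0.
pose c := '[a, b].
have cc : c * c = 1.
  have [mu mu_tr] := transported_uniform SAs SBs jphi e0_neq0.
  have := mu_tr _ _ e0_neq0 e0_neq0 _ _ Pab _ hP.
  rewrite Pab /P /rk1 e00 scale1r e00 (mu_one SAs SBs jphi e00 mu_tr) => <-.
  by rewrite dotZl.
have c1 : c = 1 \/ c = -1.
  by apply/pred2P; rewrite -sqrf_eq1 expr2 cc.
have Pcab : (fun x => c *: phi P x) = rk1 (c *: a) b by rewrite rk1Zl Pab.
have cab : '[c *: a, b] = 1 by rewrite dotZl.
have main psi : jordan_triple_bij SA SB psi -> psi P = rk1 (c *: a) b ->
    (forall y, exists s, psi (rk1 e0 y) = rk1 (c *: a) s) ->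
    (forall x, exists s, psi (rk1 x e0) = rk1 s b) ->
    exists mu T Tinv, [/\ ring_endo mu, adjointable_semilinear mu T Tinv &
      forall A, SA A -> psi A = (fun x => T (A (Tinv x)))].
  move=> jpsi psiP rows cols.
  have [mu mu_tr] := transported_uniform SAs SBs jpsi e0_neq0.
  have [T [Tinv [[TK TinvK] TL Tdual Tadj psiE]]] :=
    phi_implemented SAs SBs jpsi e00 e11 e01 mu_tr cab psiP rows cols.
  exists mu, T, Tinv; split=> //; split.
  - exact: (mu_one SAs SBs jpsi e00 mu_tr).
  - exact: (mu_add SAs SBs jpsi e00 e11 e01 mu_tr).
  - exact: (mu_mul SAs SBs jpsi e00 mu_tr).
have cphi A psi : (fun x => c *: phi A x) = psi -> phi A = (fun x => c *: psi x).
  by move=> <-; apply/funext => x; rewrite scalerA cc scale1r.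
have jcphi := jordan_triple_sign cc jphi.
have [mu mu_tr] := transported_uniform SAs SBs jcphi e0_neq0.
have [[rows cols]|[rows cols]] := phi_rk1_dichotomy SAs SBs jcphi e00 e11 e01 mu_tr Pcab.
  have [nu [T [Tinv [nuE TE phiE]]]] := main _ jcphi Pcab rows cols.
  exists c, nu, T, Tinv; split=> //; left=> A hA.
  exact: (cphi _ _ (phiE _ hA)).
have jphi2 := jordan_triple_hadj jcphi.
have [||| nu [T [Tinv [nuE TE phiE]]]] := main _ jphi2.
- by rewrite hadj_rk1.
- by move=> y; rewrite hadj_rk1.
- by move=> x; rewrite hadj_rk1.
exists c, nu, T, Tinv; split=> //; right=> A hA.
apply: (cphi _ (fun x => T (hadj form A (Tinv x)))).
by have := phiE _ (sa_hadj SAs hA); rewrite (hadjK SAs hA).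
Qed.

End Structure.

(** * The domain as a pre-Hilbert space *)

Lemma inner_CauchySchwarz (R : realType) (H : hilbertType R) (u v : H) :
  `|inner u v| <= `|u| * `|v|.
Proof.
rewrite -(ler_pXn2r (ltn0Sn 1)) ?nnegrE ?mulr_ge0 // exprMn -!innerxx.
exact: dot_CauchySchwarz.
Qed.

Section DomainDot.
Context {R : realType} {H : hilbertType R} (D : submodClosed H).

(** [dom_form] below packages this function together with its structure of positive
    definite form. *)
Definition dom_dot (x y : dom D) : R[i] := inner (dom_incl x) (dom_incl y).

Let dom_dot_bilinear :
  bilinear_for (GRing.Scale.Law.clone _ _ *%R _)
    (GRing.Scale.Law.clone _ _ (Num.conj \; *%R) _) dom_dot.
Proof.
split=> [y a x x'|x a y y']; rewrite /dom_dot [dom_incl (_ + _)]linearP.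
  by rewrite (linearDl inner) (linearZl_LR inner).
by rewrite (linearDr inner) (linearZr_LR inner).
Qed.

HB.instance Definition _ := bilinear_isBilinear.Build R[i] (dom D) (dom D) R[i]
  _ _ dom_dot dom_dot_bilinear.

Let dom_dot_herm x y : dom_dot x y = (-1) ^+ false * Num.conj (dom_dot y x).
Proof. by rewrite /dom_dot hermC. Qed.

HB.instance Definition _ := isHermitianSesquilinear.Build R[i] (dom D) false
  (@Num.conj R[i]) dom_dot dom_dot_herm.

Let dom_dot_gt0 x : x != 0 -> 0 < dom_dot x x.
Proof.
move=> x0; rewrite /dom_dot dnorm_gt0; apply: contra_neq x0 => x0.
have eq0 : dom_incl x = dom_incl (0 : dom D) by rewrite x0 raddf0.
exact: val_inj eq0.
Qed.

HB.instance Definition _ := isDotProduct.Build R[i] (dom D) dom_dot dom_dot_gt0.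


Definition dom_form : {dot dom D for @Num.conj R[i]} := dom_dot.

Lemma dom_formE x y : dom_form x y = inner (dom_incl x) (dom_incl y).
Proof. by []. Qed.

Lemma dom_inclD (x y : dom D) : dom_incl (x + y) = dom_incl x + dom_incl y.
Proof. exact: raddfD. Qed.

Lemma dom_inclZ a (x : dom D) : dom_incl (a *: x) = a *: dom_incl x.
Proof. exact: linearZ. Qed.

Lemma dom_incl_sum n (F : 'I_n -> dom D) :
  dom_incl (\sum_(i < n) F i) = \sum_(i < n) dom_incl (F i).
Proof. exact: raddf_sum. Qed.

Local Notation "''[' u , v ]" := (dom_form u%R v%R) : ring_scope.

(** A point [y] of the domain within distance less than [`|x|] of [x] would violate
    the Pythagorean identity. *)
Lemma dense_orthogonal (x : H) : dense [set x : H | x \in D] ->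
  (forall d : dom D, inner (dom_incl d) x = 0) -> x = 0.
Proof.
move=> Ddense xD; apply: contrapT => /eqP x0.
have x_gt0 : 0 < `|x| by rewrite normr_gt0.
have [|y [xy Dy]] := Ddense (ball x `|x|) _ (ball_open _ _).
  by exists x; apply: ballxx.
move: xy; rewrite -ball_normE /= => xy.
have yx : inner y x = 0 := xD (exist _ y Dy).
have : `|x - y| ^+ 2 = `|x| ^+ 2 + `|y| ^+ 2.
  have xy0 : inner x y = 0 by rewrite (dotC inner) yx rmorph0.
  by rewrite -!innerxx dnormB xy0 rmorph0 addr0 subr0.
move=> pyth.
have : `|x - y| ^+ 2 < `|x| ^+ 2 by rewrite ltrXn2r.
by rewrite pyth gtrDl => /lt_geF; rewrite exprn_ge0.
Qed.

Lemma Lplus_adjoint A : Lplus A -> adjoint_pair dom_form A (adj_plus A).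
Proof.
move=> [_ domA plusA] x y.
have h : adjoint_graph A (dom_incl y) (adjoint A (dom_incl y)).
  exact: xgetPex (domA y).
apply: etrans (h x) _.
by rewrite dom_formE /dom_incl insubdK.
Qed.

(** Density makes the Hilbert space adjoint unique, so that it is enough to exhibit
    one adjoint acting on the domain. *)
Lemma LplusP A : dense [set x : H | x \in D] ->
  Lplus A <-> exists B, adjoint_pair dom_form A B.
Proof.
move=> Ddense; split.
- by move=> /Lplus_adjoint AA; exists (adj_plus A).
- move=> [B AB]; have lA := adjoint_pair_linear AB.
  have graph y : adjoint_graph A (dom_incl y) (dom_incl (B y)) by move=> x; exact: AB.
  split=> // y; first by exists (dom_incl (B y)).
  rewrite /adjoint.
  have -> : xget 0 [set eta | adjoint_graph A (dom_incl y) eta] = dom_incl (B y).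
    apply: (xget_unique _ (graph y)) => eta h; apply/eqP; rewrite -subr_eq0; apply/eqP.
    apply: dense_orthogonal => // d.
    by rewrite (dotBr inner) -h -graph subrr.
  exact: valP (B y).
Qed.

Lemma adj_plusE A : Lplus A -> adj_plus A = hadj dom_form A.
Proof. by move=> /Lplus_adjoint /hadjE ->. Qed.

Lemma standard_star_algebraP S : dense [set x : H | x \in D] ->
  standard_star_algebra S -> star_algebra dom_form S.
Proof.
move=> Ddense SS; split.
- move=> A hA; exists (adj_plus A); first exact: ssa_plus.
  exact/Lplus_adjoint/(ssa_Lplus SS).
- move=> f g; apply: (ssa_finite_rank SS); split.
    by apply/(LplusP _ Ddense); exists (rk1 dom_form g f); exact: rk1_adjoint.
  exists 1%N, (fun=> f) => y [x _ <-]; exists (fun=> dom_form x g).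
  by rewrite big_ord1.
- exact: ssa_add SS.
- exact: ssa_scale SS.
- move=> A B hA hB; exact: (ssa_mul SS hA hB).
Qed.

End DomainDot.

(** * An orthonormal sequence in the domain *)

Section OrthonormalSequence.
Context {R : realType} {H : hilbertType R} (D : submodClosed H).
Local Notation "''[' u , v ]" := (dom_form D u%R v%R) : ring_scope.
Implicit Types (d x y : dom D) (s : seq (dom D)).

Definition orthonormal_seq s := forall i j, (i < size s)%N -> (j < size s)%N ->
  '[s`_i, s`_j] = (i == j)%:R.

Lemma sum_orthonormal s (c : nat -> R[i]) j : orthonormal_seq s -> (j < size s)%N ->
  '[\sum_(i < size s) c i *: s`_i, s`_j] = c j.
Proof.
move=> os js; rewrite dot_suml.
rewrite (bigD1 (Ordinal js)) //= big1 ?addr0 => [|i ij].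
  by rewrite dotZl os // eqxx mulr1.
by rewrite dotZl os // (negPf (_ : (i : nat) != j)) ?mulr0.
Qed.

(** Otherwise every vector [d] of the domain is its own projection [p d] on the span
    of [s]; by density the same projection formula holds in the whole space, which
    would then be finite dimensional. *)
Lemma orthonormal_extend s : ~ finite_dim [set: H] -> dense [set x : H | x \in D] ->
  orthonormal_seq s -> exists d, '[d, d] = 1 /\
    forall i, (i < size s)%N -> '[d, s`_i] = 0.
Proof.
move=> Hinf Ddense os; apply: contrapT => noext; apply: Hinf.
pose p d := \sum_(i < size s) '[d, s`_i] *: s`_i.
have dp d : d = p d.
  apply/eqP; rewrite -subr_eq0; apply: contrapT => /negP; set w := d - p d => w0.
  have w2 : 0 < '[w, w] by rewrite dnorm_gt0.
  apply: noext; exists ((sqrtC '[w, w])^-1 *: w); split.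
    rewrite dnormZ normfV ger0_norm ?sqrtC_ge0 ?ltW // exprVn sqrtCK mulVf //.
    by rewrite gt_eqF.
  move=> i si; have ws : '[w, s`_i] = 0.
    rewrite /w dotBl; apply/eqP; rewrite subr_eq0 eq_sym; apply/eqP.
    exact: (sum_orthonormal (fun i => '[d, s`_i]) os si).
  by rewrite dotZl ws mulr0.
exists (size s), (fun i => dom_incl s`_i) => x _.
exists (fun i => inner x (dom_incl s`_i)); apply/eqP; rewrite -subr_eq0; apply/eqP.
apply: (dense_orthogonal Ddense) => d.
rewrite (dotBr inner) {1}(dp d) /p.
rewrite dom_incl_sum (dot_suml inner) (dot_sumr inner).
apply/eqP; rewrite subr_eq0; apply/eqP/eq_bigr => i _.
rewrite dom_inclZ (dotZl inner) (dotZr inner) -(dotC inner).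
by rewrite mulrC.
Qed.

Lemma orthonormal_sequence : ~ finite_dim [set: H] -> dense [set x : H | x \in D] ->
  exists e : nat -> dom D, forall i j, '[e i, e j] = (i == j)%:R.
Proof.
move=> Hinf Ddense.
have ext s : exists d, orthonormal_seq s -> '[d, d] = 1 /\
    forall i, (i < size s)%N -> '[d, s`_i] = 0.
  have [os|nos] := pselect (orthonormal_seq s); last by exists 0.
  by have [d hd] := orthonormal_extend Hinf Ddense os; exists d.
have [next hnext] := choice ext.
pose seqs n := iter n (fun s => rcons s (next s)) [::].
have szs n : size (seqs n) = n by elim: n => // n IH; rewrite size_rcons IH.
have os n : orthonormal_seq (seqs n).
  elim: n => [|n IH] i j; first by rewrite szs.
  rewrite szs !ltnS /= -/(seqs n) !nth_rcons szs => i_n j_n.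
  have [dd dorth] := hnext _ IH; rewrite szs in dorth.
  have {i_n}[->|i_n] := predU1P (etrans (esym (leq_eqVlt i n)) i_n);
    have {j_n}[->|j_n] := predU1P (etrans (esym (leq_eqVlt j n)) j_n).
  - by rewrite ltnn eqxx dd.
  - by rewrite ltnn eqxx j_n dorth // gtn_eqF.
  - by rewrite ltnn eqxx i_n dotC dorth // rmorph0 ltn_eqF.
  - by rewrite i_n j_n IH ?szs.
have nths n i : (i < n)%N -> (seqs n)`_i = next (seqs i).
  elim: n => // n IH; rewrite ltnS /= -/(seqs n) nth_rcons szs => i_n.
  by move: i_n; rewrite leq_eqVlt => /predU1P[->|i_n]; rewrite ?ltnn ?eqxx // i_n IH.
exists (fun n => next (seqs n)) => i j.
rewrite -(nths (maxn i j).+1 i) ?ltnS ?leq_maxl //.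
rewrite -(nths (maxn i j).+1 j) ?ltnS ?leq_maxr //.
by rewrite os // szs ltnS ?leq_maxl ?leq_maxr.
Qed.

End OrthonormalSequence.

(** * Convergent series in the graph topology *)

Section GraphGauges.
Context {R : realType} {H : hilbertType R} (D : submodClosed H).
Local Notation "''[' u , v ]" := (dom_form D u%R v%R) : ring_scope.
Implicit Types (x y : dom D) (A : dom D -> dom D).

(** Up to order [n], the seminorms that define the graph topology, rescaled so
    that [gauge s eps n x < 1] forces [`|A x| < eps j] for all [A] in [s j], [j <= n]. *)
Definition gauge (s : nat -> seq (dom D -> dom D)) (eps : nat -> R[i]) n x : R[i] :=
  \sum_(j < n.+1) \sum_(A <- s j) `|dom_incl (A x)| / eps j.

(** Metrizability gives a countable base of neighbourhoods of [0]; each of them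
    contains a basic graph ball [(s n, eps n)], and the gauges of these balls define
    the topology. *)
Lemma frechet_gauges : metrizable R (graph_space D) ->
  exists p : nat -> dom D -> R[i],
  [/\ forall n x, 0 <= p n x, forall n x y, p n (x + y) <= p n x + p n y,
      forall n a x, p n (a *: x) = `|a| * p n x,
      forall m n x, (m <= n)%N -> p m x <= p n x &
      forall E, graph_ent (D := D) E -> exists j, forall x y, p j (x - y) < 1 -> E (x, y)].
Proof.
move=> [d [_ _ _ dnbhs]].
pose o : graph_space D := (0 : dom D).
have base n : exists q : seq (dom D -> dom D) * R[i],
    [/\ forall A, A \in q.1 -> Lplus A, 0 < q.2 &
     forall y, graph_ball q.1 q.2 (o, y) -> d o y < n.+1%:R^-1].
  have : nbhs o [set y | d o y < n.+1%:R^-1].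
    by apply/dnbhs; exists n.+1%:R^-1; rewrite // invr_gt0.
  rewrite -nbhs_entourageE => -[E [s [eps [sL eps0 sE]]] EU].
  exists (s, eps); split=> // y ys; apply: EU; apply/xsectionP.
  exact: sE.
have [q hq] := choice base.
pose s n := (q n).1; pose eps n := (q n).2.
have eps0 n : 0 < eps n by have [] := hq n.
have epsV n : 0 <= (eps n)^-1 by rewrite invr_ge0 ltW.
have sl n A : A \in s n -> linear A by have [h _ _] := hq n => /h[].
exists (gauge s eps); split.
- by move=> n x; do 2!apply: sumr_ge0 => ? _; rewrite mulr_ge0.
- move=> n x y; rewrite /gauge -big_split ler_sum // => j _ /=.
  rewrite -big_split /= big_seq [leRHS]big_seq ler_sum // => A As /=.
  by rewrite (linear_atD _ _ (sl _ _ As)) dom_inclD -mulrDl ler_wpM2r // ler_normD.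
- move=> n a x; rewrite /gauge mulr_sumr; apply: eq_bigr => j _.
  rewrite mulr_sumr big_seq [RHS]big_seq; apply: eq_bigr => A As.
  by rewrite (linear_atZ _ _ (sl _ _ As)) dom_inclZ normrZ mulrA.
- move=> m n x mn; rewrite /gauge.
  rewrite -!(big_mkord xpredT (fun j => \sum_(A <- s j) `|dom_incl (A x)| / eps j)).
  rewrite [leRHS](big_cat_nat (n := m.+1)) //= lerDl.
  by do 2!apply: sumr_ge0 => ? _; rewrite mulr_ge0.
- move=> E [t [e [tL e0 tE]]].
  have : nbhs o (xsection (graph_ball t e) o).
    by apply: nbhs_entourage; exists t, e; split.
  move=> /dnbhs [r r0 rU].
  have [j jr] : exists j : nat, j.+1%:R^-1 < r.
    exists (Num.truncn r^-1); rewrite invf_plt ?posrE //.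
    exact: truncnS_gt.
  exists j => x y pxy; apply: tE => A At /=.
  have [_ _ /(_ (y - x)) hj] := hq j.
  have : xsection (graph_ball t e) o (y - x).
    apply: rU; apply: lt_trans jr; apply: hj => B Bs /=.
    rewrite sub0r opprB; apply: le_lt_trans (_ : eps j * gauge s eps j (x - y) < _); last first.
      by rewrite gtr_pMr.
    rewrite -ler_pdivrMl // mulrC.
    rewrite /gauge big_ord_recr /= (big_rem B) //=.
    rewrite addrCA lerDl addr_ge0 //.
      by do 2!apply: sumr_ge0 => ? _; rewrite mulr_ge0.
    by apply: sumr_ge0 => ? _; rewrite mulr_ge0.
  move=> /xsectionP /(_ A At) /=; by rewrite sub0r opprB.
Qed.

(** With [`|c n| * p n (e n) <= 2 ^- (n + 1)] the partial sums [X n] of the series of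
    the [c n *: e n] are Cauchy for every gauge.  The identity is one of the seminorms
    of the graph topology, so the coefficients pass to the limit. *)
Lemma frechet_series (e : nat -> dom D) :
  dense [set x : H | x \in D] -> graph_frechet D ->
  (forall i j, '[e i, e j] = (i == j)%:R) ->
  exists delta : nat -> R[i], (forall n, 0 < delta n) /\
    forall c : nat -> R[i], (forall n, `|c n| < delta n) ->
      exists x, forall n, '[x, e n] = c n.
Proof.
move=> Ddense [Dmetr Dcomplete] oe.
have [p [p0 pD pZ pmono pent]] := frechet_gauges Dmetr.
have q0 n : 0 < 1 + p n (e n) by rewrite ltr_pwDl.
exists (fun n => (2 ^+ n.+1)^-1 / (1 + p n (e n))); split.
  by move=> n; rewrite divr_gt0 // invr_gt0 exprn_gt0.
move=> c cdelta.
pose X n : dom D := \sum_(i < n) c i *: e i.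
have tail j m k : (j <= m)%N -> p j (X (m + k)%N - X m) <= (2 ^+ m)^-1 - (2 ^+ (m + k))^-1.
  move=> jm; elim: k => [|k IH].
    rewrite addn0 !subrr -(scale0r (X m)); have := pZ j 0 (X m).
    by rewrite normr0 mul0r => ->.
  have -> : X (m + k.+1)%N - X m = (X (m + k)%N - X m) + c (m + k)%N *: e (m + k)%N.
    by rewrite addnS /X big_ord_recr /= addrAC.
  apply: le_trans (pD _ _ _) _.
  have step : p j (c (m + k)%N *: e (m + k)%N) <= (2 ^+ (m + k).+1)^-1.
    rewrite pZ; apply: le_trans (_ : `|c (m + k)%N| * (1 + p (m + k)%N (e (m + k)%N)) <= _).
      rewrite ler_wpM2l //; apply: le_trans (pmono _ _ _ (leq_trans jm (leq_addr k m))) _.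
      by rewrite lerDr.
    by rewrite -ler_pdivlMr // ltW.
  apply: le_trans (lerD IH step) _.
  rewrite addnS -addrA lerD2l exprS invfM.
  have -> : - (2 ^+ (m + k))^-1 = - (2^-1 * (2 ^+ (m + k))^-1) - (2^-1 * (2 ^+ (m + k))^-1) :> R[i].
    by field; rewrite expf_neq0 // pnatr_eq0.
  by rewrite subrK.
have tail1 j m n : (j <= m)%N -> (m <= n)%N -> p j (X n - X m) < 1.
  move=> jm mn; rewrite -(subnKC mn); apply: le_lt_trans (tail _ _ _ jm) _.
  apply: lt_le_trans (_ : (2 ^+ m)^-1 <= _).
    by rewrite gtrBl invr_gt0 exprn_gt0.
  by rewrite invf_le1 ?exprn_gt0 // exprn_ege1 // ler1n.
have Xcauchy j m n : (j <= m)%N -> (j <= n)%N -> p j (X m - X n) < 1.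
  move=> jm jn; have [mn|/ltnW nm] := leqP m n; last exact: tail1.
  rewrite -opprB -scaleN1r pZ normrN1 mul1r; exact: tail1.
have [|x Xx] := Dcomplete ((X : nat -> graph_space D) @ \oo).
  move=> E /pent[j jE].
  exists ([set X n | n in [set n | (j <= n)%N]], [set X n | n in [set n | (j <= n)%N]]).
    by split; exists j => // n /= jn; exists n.
  move=> [a b] /= [[m jm Xm] [n jn Xn]]; rewrite /= in Xm Xn.
  by rewrite -Xm -Xn; apply: jE; exact: Xcauchy.
exists x => n; apply/eqP; rewrite -subr_eq0 -normr_le0; apply/ler_addgt0Pr => r r0.
rewrite add0r.
have : nbhs x (xsection (graph_ball [:: id] r) x).
  apply: nbhs_entourage; exists [:: id], r; split=> // A; rewrite inE => /eqP ->.
  by apply/(LplusP _ Ddense); exists id.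
move=> /Xx [N _ hN].
have /xsectionP /(_ id (mem_head _ _)) /= xX := hN (maxn N n.+1) (leq_maxl _ _).
have Xn : '[X (maxn N n.+1), e n] = c n.
  rewrite /X dot_suml (bigD1 (Ordinal (leq_maxr N n.+1))) //= big1 ?addr0.
    by rewrite dotZl oe eqxx mulr1.
  by move=> i ni; rewrite dotZl oe (negPf (_ : (i : nat) != n)) ?mulr0.
rewrite -Xn -dotBl dom_formE.
apply: le_trans (inner_CauchySchwarz _ _) _.
have -> : `|dom_incl (e n)| = 1.
  by apply/eqP; rewrite -(sqrp_eq1 (normr_ge0 _)) -innerxx -dom_formE oe eqxx.
by rewrite mulr1 ltW.
Qed.

End GraphGauges.

(** * The scalar function is the identity or the conjugation *)

Section ComplexEndo.
Context {R : realType}.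
Local Notation C := R[i].

Lemma complex_nat_bound (a : C) : 0 <= a -> exists n : nat, a < n%:R.
Proof.
move=> a0; have aE : a = (complex.Re a)%:C%C by rewrite RRe_real // ger0_real.
exists (Num.truncn (complex.Re a)).+1.
by rewrite aE -(rmorph_nat (real_complex R)) ltcR; exact: truncnS_gt.
Qed.

Lemma natmul_bounded_eq0 (a b : C) : 0 <= a -> (forall n, n%:R * a <= b) -> a = 0.
Proof.
move=> a0 ab; apply/eqP; apply: contrapT => /negP a_neq0.
have a_gt0 : 0 < a by rewrite lt_def a_neq0.
have b0 : 0 <= b by have := ab 0%N; rewrite mul0r.
have [n] := complex_nat_bound (divr_ge0 b0 a0).
by rewrite ltr_pdivrMr // => /lt_geF; rewrite ab.
Qed.

(** Integers are fixed by [mu], so [n (mu r - r) = mu t - t] where [t] is the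
    fractional part of [n r], for [r] real; the right hand side is bounded independently
    of [n], hence [mu] fixes the reals.  It maps ['i] to a square root of [-1]. *)
Lemma bounded_ring_endo (mu : C -> C) (delta M : C) : ring_endo mu -> 0 < delta ->
  (forall a, `|a| < delta -> `|mu a| <= M) ->
  (forall a, mu a = a) \/ (forall a, mu a = Num.conj a).
Proof.
move=> [mu1 muD muM] delta0 bound.
have mu0 : mu 0 = 0 by have /eqP := muD 0 0; rewrite addr0 -subr_eq subrr => /eqP.
have muN a : mu (- a) = - mu a.
  by apply/eqP; rewrite -addr_eq0 -muD addNr mu0.
have muB : zmod_morphism mu by move=> a b; rewrite muD muN.
have muMon : monoid_morphism mu by split.
pose f : {rmorphism C -> C} := HB.pack mu
  (GRing.isZmodMorphism.Build C C mu muB) (GRing.isMonoidMorphism.Build C C mu muMon).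
have [K hK] := complex_nat_bound (ltW (etrans (invr_gt0 _) delta0)).
have K0 : 0 < K%:R :> C by apply: lt_trans hK; rewrite invr_gt0.
have unit_bound t : `|t| <= 1 -> `|mu t| <= K%:R * M.
  move=> t1; have -> : t = K%:R * (t / K%:R) by field; rewrite gt_eqF.
  rewrite muM -[mu K%:R]/(f K%:R) rmorph_nat normrM normr_nat ler_wpM2l //.
  apply: bound; rewrite normrM normfV normr_nat ltr_pdivrMr //.
  by apply: le_lt_trans t1 _; rewrite -ltr_pdivrMl // mulr1.
have real_fix (r : R) : mu r%:C%C = r%:C%C.
  apply/eqP; rewrite -subr_eq0 -normr_eq0; apply/eqP.
  apply: (@natmul_bounded_eq0 _ (K%:R * M + 1)) => // n.
  pose m := Num.floor (n%:R * r); pose t := n%:R * r - m%:~R.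
  have t01 : 0 <= t <= 1.
    have /andP[m_le lt_m] := floor_itv (n%:R * r).
    by rewrite /t subr_ge0 m_le lerBlDl -[1]/(1%:~R) -intrD ltW.
  have nr : n%:R * r%:C%C = t%:C%C + m%:~R :> C.
    rewrite /t rmorphB rmorphM rmorph_nat rmorph_int subrK //.
  have -> : n%:R * `|mu r%:C%C - r%:C%C| = `|mu t%:C%C - t%:C%C|.
    rewrite -[n%:R in LHS]normr_nat -normrM mulrBr nr.
    rewrite -[n%:R in LHS](rmorph_nat f) -[mu r%:C%C]/(f r%:C%C) -rmorphM nr.
    by rewrite rmorphD rmorph_int -[mu t%:C%C]/(f t%:C%C); congr `|_|; ring.
  apply: le_trans (ler_normB _ _) _.
  have t1 : `|t%:C%C| <= 1 :> C.
    have [t0 t1] := andP t01.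
    by rewrite ger0_norm lecR.
  by rewrite lerD // unit_bound.
have /eqP : f 'i ^+ 2 = 'i ^+ 2 by rewrite -rmorphXn sqrCi rmorphN1.
have real_part (a : C) : a = (complex.Re a)%:C%C + 'i * (complex.Im a)%:C%C.
  by rewrite -complexiE -complexE.
rewrite eqf_sqr => /orP[] /eqP fi; [left|right] => a.
  by rewrite [in RHS](real_part a) (real_part a) muD muM !real_fix -[mu 'i]/(f 'i) fi.
rewrite [in LHS](real_part a) [in RHS](real_part a).
rewrite muD muM !real_fix -[mu 'i]/(f 'i) fi rmorphD rmorphM /= conjCi.
have conj_real (r : R) : Num.conj r%:C%C = r%:C%C :> C.
  by apply/CrealP; rewrite complex_real.
by rewrite !conj_real.
Qed.
End ComplexEndo.

Section Semilinear.
Context {R : realType} {H : hilbertType R} (D : submodClosed H).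
Local Notation "''[' u , v ]" := (dom_form D u%R v%R) : ring_scope.

(** If the factor is unbounded near [0], choose [c n] so small that some [x] has
    coefficients [c n], yet with [`|mu (c n)| > n * `|z n|], where [z n] is dual to
    [e n].  Then [`|T x| > n] for all [n]. *)
Lemma semilinear_factor_bounded (mu : R[i] -> R[i]) (T : dom D -> dom D) :
  ~ finite_dim [set: H] -> dense [set x : H | x \in D] -> graph_frechet D ->
  (forall y, exists z, forall x, '[T x, z] = mu '[x, y]) ->
  exists delta M : R[i], 0 < delta /\ forall a, `|a| < delta -> `|mu a| <= M.
Proof.
move=> Hinf Ddense DF Tdual.
have [e oe] := orthonormal_sequence Hinf Ddense.
have [delta [delta0 series]] := frechet_series Ddense DF oe.
have [z hz] := choice (fun n => Tdual (e n)).
apply: contrapT => unbounded.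
have large n : exists a, `|a| < delta n /\ n%:R * `|dom_incl (z n)| < `|mu a|.
  apply: contrapT => nlarge; apply: unbounded.
  exists (delta n), (n%:R * `|dom_incl (z n)|); split=> // a ad.
  rewrite real_leNgt ?normr_real ?rpredM ?realn ?normr_real //.
  by apply/negP => na; apply: nlarge; exists a.
have [c hc] := choice large.
have [x hx] := series c (fun n => (hc n).1).
have [n xn] := complex_nat_bound (normr_ge0 (dom_incl (T x))).
have [_] := hc n; rewrite -hx -hz dom_formE => /lt_geF/negbT/negP; apply.
apply: le_trans (inner_CauchySchwarz _ _) _.
by rewrite ler_wpM2r // ltW.
Qed.

End Semilinear.

(** * Removing the constant, and the conclusion *)

Section Rescaling.
Context {C : numClosedFieldType} {V : lmodType C} (form : {dot V for Num.conj}).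
Context {SA SB : set (V -> V)} (SAs : star_algebra form SA)
  (SBs : star_algebra form SB).

Lemma jordan_triple_rescale (s : C) (Phi : (V -> V) -> (V -> V)) : s != 0 ->
  set_bij SA SB Phi ->
  (forall A B, SA A -> SA B -> Phi (fun x => s ^+ 2 *: A (B (A x)))
     = (fun x => s ^+ 2 *: Phi A (Phi B (Phi A x)))) ->
  jordan_triple_bij SA SB (fun A x => s *: Phi (fun y => s^-1 *: A y) x).
Proof.
move=> s0 [Phi_im Phi_inj Phi_surj] Phi_triple; split; first split.
- by move=> A /(sa_scale SAs s^-1)/Phi_im/(sa_scale SBs s).
- move=> A B /[!in_setE] hA hB AB.
  have /Phi_inj : Phi (fun y => s^-1 *: A y) = Phi (fun y => s^-1 *: B y).
    by apply/funext => x; apply: (scalerI s0); exact: (congr1 (@^~ x) AB).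
  rewrite !in_setE => /(_ (sa_scale SAs _ hA) (sa_scale SAs _ hB)) AB'.
  apply/funext => x; apply: (scalerI (invr_neq0 s0)).
  exact: (congr1 (@^~ x) AB').
- move=> B hB; have [A hA AB] := Phi_surj _ (sa_scale SBs s^-1 hB).
  exists (fun x => s *: A x); first exact: (sa_scale SAs s hA).
  have -> : (fun y => s^-1 *: (s *: A y)) = A by apply/funext => y; rewrite scalerK.
  by rewrite AB; apply/funext => x; rewrite scalerA divff // scale1r.
- move=> A B hA hB; have hA' := sa_scale SAs s^-1 hA; have hB' := sa_scale SAs s^-1 hB.
  have lA := sa_linear SAs hA; have lB := sa_linear SAs hB.
  have lA' := sa_linear SBs (Phi_im _ hA'); have lB' := sa_linear SBs (Phi_im _ hB').
  have -> : (fun y => s^-1 *: A (B (A y))) =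
      (fun y => s ^+ 2 *: (s^-1 *: A (s^-1 *: B (s^-1 *: A y)))).
    apply/funext => y; rewrite (linear_atZ _ _ lB) !(linear_atZ _ _ lA) !scalerA.
    by congr (_ *: _); field.
  have -> : Phi (fun y => s ^+ 2 *: (s^-1 *: A (s^-1 *: B (s^-1 *: A y)))) = _
    := Phi_triple _ _ hA' hB'.
  apply/funext => x; rewrite (linear_atZ _ _ lA') (linear_atZ _ _ lB').
  by rewrite !(linear_atZ _ _ lA') !scalerA expr2 mulrA.
Qed.

End Rescaling.

Theorem proposition3p2 (R : realType) (H : hilbertType R) (D : submodClosed H)
    (H_infinite : ~ finite_dim [set: H])
    (D_dense : dense [set x : H | x \in D])
    (D_frechet : graph_frechet D)
    (AA BB : set (dom D -> dom D))
    (AA_std : standard_star_algebra AA) (BB_std : standard_star_algebra BB)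
    (k : rat) (k_neq0 : k != 0)
    (Phi : (dom D -> dom D) -> (dom D -> dom D))
    (Phi_bij : set_bij AA BB Phi)
    (Phi_triple : forall A B, AA A -> AA B ->
      Phi (fun x => (ratr k : R[i]) *: A (B (A x)))
      = (fun x => (ratr k : R[i]) *: Phi A (Phi B (Phi A x)))) :
  (exists (c : R[i]) (Psi : (dom D -> dom D) -> (dom D -> dom D)),
    [/\ c = 1 \/ c = -1,
        ring_isomorphism AA BB Psi \/ ring_antiisomorphism AA BB Psi &
        forall A, AA A -> Phi A = (fun x => c *: Psi A x)])
  /\
  ((exists (T Tinv : dom D -> dom D) (c : R[i]),
     [/\ cancel T Tinv /\ cancel Tinv T,
         linear T \/ conj_linear T,
         c = -1 \/ c = 1,
         forall A, AA A -> Phi A = (fun x => c *: T (A (Tinv x))) &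
         linear T -> Lplus T])
   \/
   (exists (T Tinv : dom D -> dom D) (c : R[i]),
     [/\ cancel T Tinv /\ cancel Tinv T,
         linear T \/ conj_linear T,
         c = -1 \/ c = 1,
         forall A, AA A -> Phi A = (fun x => c *: T (adj_plus A (Tinv x))) &
         linear T -> Lplus T])).
Proof.
have SAs := standard_star_algebraP D_dense AA_std.
have SBs := standard_star_algebraP D_dense BB_std.
pose s : R[i] := sqrtC (ratr k).
have s2 : s ^+ 2 = ratr k by rewrite sqrtCK.
have s0 : s != 0 by rewrite sqrtC_eq0 fmorph_eq0.
have [e oe] := orthonormal_sequence H_infinite D_dense.
have e0_neq0 : e 0%N != 0 by rewrite -(dnorm_eq0 (dom_form D)) oe oner_eq0.
rewrite -s2 in Phi_triple.
have jphi := jordan_triple_rescale SAs SBs s0 Phi_bij Phi_triple.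
have [c [mu [T [Tinv [c1 mu_endo [TK TinvK TL Tdual Tadj] phi_form]]]]] :=
  jordan_triple_implemented SAs SBs jphi (oe 0 0)%N (oe 1 1)%N (oe 0 1)%N.
have [delta [M [delta0 mu_bound]]] :=
  semilinear_factor_bounded H_infinite D_dense D_frechet Tdual.
have mu_id := bounded_ring_endo mu_endo delta0 mu_bound.
have T_lin : linear T \/ conj_linear T.
  by case: mu_id => muE; [left|right] => a x y; rewrite TL muE.
(* A linear [T] forces [mu] to be the identity, and then the twisted adjoint of [T]
   is an adjoint. *)
have T_Lplus : linear T -> Lplus T.
  move=> Tlin; apply/(LplusP _ D_dense).
  have T0 : T 0 = 0 := linear_at0 Tlin.
  have muE a : mu a = a.
    have := TL a (e 0%N) 0; rewrite !addr0 T0 addr0 (linear_atZ _ _ Tlin) => /esym/eqP.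
    rewrite -subr_eq0 -scalerBl scaler_eq0 subr_eq0 => /predU1P[//|/eqP Te].
    by move: e0_neq0; rewrite -(TK (e 0%N)) Te -T0 TK T0 eqxx.
  have [B hB] := choice Tadj; exists B => x y.
  by rewrite hB muE.
have T0 : T 0 = 0.
  have := TL 1 0 0; rewrite (re_one mu_endo) !scale1r addr0 => /eqP.
  by rewrite -subr_eq subrr eq_sym => /eqP.
have TD x y : T (x + y) = T x + T y.
  by have := TL 1 x y; rewrite (re_one mu_endo) !scale1r.
have TZ a x : T (a *: x) = mu a *: T x by have := TL a x 0; rewrite !addr0 T0 addr0.
have muk : mu (ratr k) = ratr k.
  by case: mu_id => ->; rewrite // fmorph_rat.
(* The scalar that undoes the rescaling by [s] is a sign because its square is
   [mu k / k = 1]. *)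
have sign t : t ^+ 2 = ratr k -> s^-1 * c * mu t = 1 \/ s^-1 * c * mu t = -1.
  move=> t2; apply/pred2P; rewrite -sqrf_eq1 !exprMn exprVn s2 (expr2 (mu t)).
  rewrite -(re_mul mu_endo) -expr2 t2 muk.
  have -> : c ^+ 2 = 1 by case: c1 => ->; rewrite ?sqrrN expr1n.
  by rewrite mulr1 mulVf // fmorph_eq0.
have Phi_phi A : Phi A = (fun x => s^-1 *: (s *: Phi (fun y => s^-1 *: (s *: A y)) x)).
  have -> : (fun y => s^-1 *: (s *: A y)) = A by apply/funext => y; rewrite scalerK.
  by apply/funext => x; rewrite scalerK.
have signK d : d = 1 \/ d = -1 -> d * d = 1 :> R[i].
  by case=> ->; rewrite ?mulrNN mulr1.
case: phi_form => phiE.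
- have [d [d1 PhiE]] : exists d : R[i], (d = 1 \/ d = -1) /\
      forall A, AA A -> Phi A = (fun x => d *: T (A (Tinv x))).
    exists (s^-1 * c * mu s); split; first exact: sign.
    move=> A hA; rewrite Phi_phi; apply/funext => x.
    have := congr1 (@^~ x) (phiE _ (sa_scale SAs s hA)) => /= ->.
    by rewrite TZ !scalerA.
  split; last by left; exists T, Tinv, d; split=> //; case: d1; [right|left].
  pose Psi A x := d *: Phi A x.
  have PsiE A : AA A -> Psi A = (fun x => T (A (Tinv x))).
    by move=> hA; apply/funext => x; rewrite /Psi PhiE // scalerA signK // scale1r.
  exists d, Psi; split=> //; last first.
    by move=> A hA; apply/funext => x; rewrite /Psi scalerA signK // scale1r.
  left; split; first by apply: (set_bij_sign SBs) => //; exact: signK.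
  + move=> A B hA hB; rewrite !PsiE //; last exact: (sa_add SAs hA hB).
    by apply/funext => x; rewrite TD.
  + move=> A B hA hB; rewrite !PsiE //; last exact: (sa_mul SAs hA hB).
    by apply/funext => x /=; rewrite TK.
- have [d [d1 PhiE]] : exists d : R[i], (d = 1 \/ d = -1) /\
      forall A, AA A -> Phi A = (fun x => d *: T (adj_plus A (Tinv x))).
    exists (s^-1 * c * mu (Num.conj s)); split.
      by apply: sign; rewrite -rmorphXn s2 /= fmorph_rat.
    move=> A hA; rewrite Phi_phi; apply/funext => x.
    have := congr1 (@^~ x) (phiE _ (sa_scale SAs s hA)) => /= ->.
    rewrite (hadj_scale _ SAs hA) TZ !scalerA adj_plusE //.
    exact: ssa_Lplus AA_std _ hA.
  split; last by right; exists T, Tinv, d; split=> //; case: d1; [right|left].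
  pose Psi A x := d *: Phi A x.
  have PsiE A : AA A -> Psi A = (fun x => T (adj_plus A (Tinv x))).
    by move=> hA; apply/funext => x; rewrite /Psi PhiE // scalerA signK // scale1r.
  exists d, Psi; split=> //; last first.
    by move=> A hA; apply/funext => x; rewrite /Psi scalerA signK // scale1r.
  have plusE A : AA A -> adj_plus A = hadj (dom_form D) A.
    by move=> /(ssa_Lplus AA_std)/adj_plusE.
  right; split; first by apply: (set_bij_sign SBs) => //; exact: signK.
  + move=> A B hA hB; have hAB := sa_add SAs hA hB.
    rewrite !PsiE // !plusE // (hadj_add SAs hA hB).
    by apply/funext => x; rewrite TD.
  + move=> A B hA hB; have hAB : AA (A \o B) := sa_mul SAs hA hB.
    rewrite !PsiE // !plusE // [hadj _ (A \o B)](hadj_comp SAs hA hB).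
    by apply/funext => x /=; rewrite TK.
Qed.
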